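(* Let $G$ be a non-elementary hyperbolic group and let $H\le G$ be a quasiconvex subgroup of infinite index. Then there exists a free quasiconvex subgroup of rank two $F\le G$ which is conjugacy separated from $H$ in $G$, that is, for any $g\in G$ $$g^{-1}Hg\cap F=1.$$
   Context: A finitely generated group $G$ is (word-)hyperbolic if for any finite generating set $A$ there is $\delta\ge 0$ such that in every geodesic triangle in the Cayley graph $\Gamma(G,A)$ each side is contained in the closed $\delta$-neighborhood of the union of the other two sides. A hyperbolic group is non-elementary if it is not virtually cyclic (finite groups count as virtually cyclic). A subgroup $H$ of a hyperbolic group $G$ is quasiconvex if for any finite generating set $A$ of $G$ there is $\epsilon\ge0$ such that every geodesic in $\Gamma(G,A)$ with both endpoints in $H$ is contained in the $\epsilon$-neighborhood of $H$. *)

(* Defs.v *)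
From HB Require Import structures.
From mathcomp Require Import all_boot all_order all_algebra.
From mathcomp Require Import all_classical all_reals.

Set Implicit Arguments.
Unset Strict Implicit.
Unset Printing Implicit Defensive.

Import Order.TTheory GRing.Theory Num.Theory.

Local Open Scope classical_set_scope.
Local Open Scope group_scope.

Section Groups.
Context {G : groupType}.

Definition subgroup (H : set G) : Prop := group_closed [in H].

Definition generated (A : set G) : set G := smallest subgroup A.

Definition finite_generating (A : set G) : Prop :=
  finite_set A /\ generated A = [set: G].

Definition lcosets (H : set G) : set (set G) :=
  range (fun g : G => [set g * h | h in H]).

Definition finite_index (H : set G) : Prop := finite_set (lcosets H).

Definition is_cyclic (C : set G) : Prop := exists x : G, C = generated [set x].

(* The letter (i, true) stands for b i and (i, false) for its inverse. *)
Definition word_value (I : Type) (b : I -> G) (w : seq (I * bool)) : G :=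
  \prod_(u <- w) (if u.2 then b u.1 else (b u.1)^-1).

Definition reduced (I : eqType) (w : seq (I * bool)) : bool :=
  sorted (fun u v : I * bool => ~~ ((u.1 == v.1) && (u.2 != v.2))) w.

(* b freely generates F; the condition on reduced words forces b injective. *)
Definition free_basis (I : eqType) (b : I -> G) (F : set G) : Prop :=
  F = generated (range b) /\
  forall w : seq (I * bool), w != [::] -> reduced w -> word_value b w <> 1.

Definition free_of_rank (n : nat) (F : set G) : Prop :=
  exists b : 'I_n -> G, free_basis b F.

(* h ^ g is g^-1 * (h * g). *)
Definition conjugacy_separated (F H : set G) : Prop :=
  forall g : G, [set h ^ g | h in H] `&` F = [set 1].

End Groups.

Definition finitely_generated (G : groupType) : Prop :=
  exists A : set G, finite_generating A.

Definition virtually_cyclic (G : groupType) : Prop :=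
  exists C : set G, [/\ subgroup C, is_cyclic C & finite_index C].

Local Open Scope ring_scope.

Section Metric.
Context {R : realType} {X : Type}.
Variable d : X -> X -> R.

(* p, restricted to [0, l], is an isometric embedding. *)
Definition geodesic (l : R) (p : R -> X) : Prop :=
  0 <= l /\
  {in `[0, l] &, forall s t : R, d (p s) (p t) = `|s - t|}.

Definition side (l : R) (p : R -> X) : set X := p @` `[0, l].

Definition closed_nbhd (e : R) (S : set X) : set X :=
  [set x | exists2 y, S y & d x y <= e].

Definition geodesic_triangle (l1 l2 l3 : R) (p1 p2 p3 : R -> X) : Prop :=
  [/\ geodesic l1 p1, geodesic l2 p2 & geodesic l3 p3] /\
  [/\ p1 l1 = p2 0, p2 l2 = p3 0 & p3 l3 = p1 0].

Definition slim_triangles (delta : R) : Prop :=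
  forall (l1 l2 l3 : R) (p1 p2 p3 : R -> X),
    geodesic_triangle l1 l2 l3 p1 p2 p3 ->
    [/\ side l1 p1 `<=` closed_nbhd delta (side l2 p2 `|` side l3 p3),
        side l2 p2 `<=` closed_nbhd delta (side l3 p3 `|` side l1 p1) &
        side l3 p3 `<=` closed_nbhd delta (side l1 p1 `|` side l2 p2)].

End Metric.

(* The geometric realization of the Cayley graph of G with respect to A: the
   vertices are the elements of G, and for all g in G and a in A there is an
   edge of length 1 from g to g a.  [EdgePoint g a t] is the interior point of
   that edge at distance t from g along it. *)
Inductive cayley (R : realType) (G : groupType) (A : set G) : Type :=
| Vertex of G
| EdgePoint of G & A & `]0 : R, 1[%classic.

Section Cayley.
Context {R : realType} {G : groupType} {A : set G}.

(* The ends of the edge carrying p, with the distances to p along it. *)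
Definition ends (p : cayley R A) : seq (G * R) :=
  match p with
  | Vertex g => [:: (g, 0)]
  | EdgePoint g a t => [:: (g, \val t); ((g * \val a)%g, 1 - \val t)]
  end.

(* Lengths of the paths from p to q which leave the edge of p through one of
   its ends, follow an edge path and reach q through an end of its edge. *)
Definition outer_lengths (p q : cayley R A) : set R :=
  [set r | exists u v (w : seq (A * bool)),
     [/\ u \in ends p, v \in ends q, v.1 = (u.1 * word_value \val w)%g &
         r = u.2 + (size w)%:R + v.2]].

(* Lengths of the paths from p to q inside a single open edge. *)
Definition inner_lengths (p q : cayley R A) : set R :=
  [set r | exists g a t t',
     [/\ p = EdgePoint g a t, q = EdgePoint g a t' & r = `|\val t - \val t'|]].

Definition cayley_dist (p q : cayley R A) : R :=
  inf (outer_lengths p q `|` inner_lengths p q).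

End Cayley.

Definition hyperbolic (R : realType) (G : groupType) : Prop :=
  finitely_generated G /\
  forall A : set G, finite_generating A ->
    exists2 delta : R, 0 <= delta & slim_triangles (@cayley_dist R G A) delta.

Definition nonelementary_hyperbolic (R : realType) (G : groupType) : Prop :=
  hyperbolic R G /\ ~ virtually_cyclic G.

Definition quasiconvex (R : realType) (G : groupType) (H : set G) : Prop :=
  forall A : set G, finite_generating A ->
    exists2 epsilon : R, 0 <= epsilon &
      forall (l : R) (p : R -> cayley R A),
        geodesic cayley_dist l p ->
        (@Vertex R G A @` H) (p 0) -> (@Vertex R G A @` H) (p l) ->
        side l p `<=` closed_nbhd cayley_dist epsilon (@Vertex R G A @` H).

(* Main.v *)
Require Import Defs.
From mathcomp Require Import all_boot all_order all_algebra.
From mathcomp Require Import all_classical all_reals.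
From mathcomp Require Import zify lra.

(* Neumann's covering lemma shows that a group is not a finite union of sets
   x K y with K of infinite index; this is used for K = H and for cyclic K.
   A hyperbolic G which is not virtually cyclic contains a loxodromic element g,
   and conjugates of large powers of g by elements far from the double cosets of
   <g> are arbitrarily long elements s_i whose mutual overlaps (Gromov products)
   are bounded by a constant C fixed in advance.  Choose w, depending on C, far
   from H in the sense that w is not in B_R H B_R, where B_R is the ball of
   radius R.  By hyperbolicity w overlaps little with all but at most two of the
   s_i, so four of them can be used as connectors: x = s_a w s_c^-1 and
   y = s_b w s_d^-1 generate F.  A reduced word in x and y is a concatenation of
   long pieces with small overlaps, hence a quasi-geodesic; so F is free, and the
   Morse lemma makes it quasiconvex for every generating set.  If a nontrivial
   element of F, given by a cyclically reduced word, were conjugate into H, then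
   its axis, which carries copies of w, would run near a coset of H, forcing w
   into B_R H B_R. *)

Set Implicit Arguments.
Unset Strict Implicit.
Unset Printing Implicit Defensive.

(** * Neumann's covering lemma *)

Section Neumann.
Local Open Scope group_scope.
Variable G : groupType.
Implicit Types (H : set G) (T : seq G).

Lemma subgroup1 H : subgroup H -> H 1.
Proof. by case=> /set_mem. Qed.

Lemma subgroupF H x y : subgroup H -> H x -> H y -> H (x / y).
Proof. by case=> _ sH Hx Hy; apply/set_mem/sH; apply/mem_set. Qed.

Lemma subgroupV H x : subgroup H -> H x -> H x^-1.
Proof. by move=> sH Hx; rewrite -div1g; apply: subgroupF => //; apply: subgroup1. Qed.

Lemma subgroupM H x y : subgroup H -> H x -> H y -> H (x * y).
Proof. by move=> sH Hx Hy; rewrite -[y]invgK; apply: subgroupF => //; apply: subgroupV. Qed.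

Lemma subgroupX H x n : subgroup H -> H x -> H (x ^+ n).
Proof.
move=> sH Hx; elim: n => [|n IH]; first exact: subgroup1.
by rewrite expgS; apply: subgroupM.
Qed.

Lemma subgroupP H : H 1 -> (forall x y, H x -> H y -> H (x / y)) -> subgroup H.
Proof.
move=> H1 HF; split; first exact/mem_set.
by move=> x y /set_mem Hx /set_mem Hy; apply/mem_set/HF.
Qed.

(** Membership of [t^-1 * c] in [H] encodes that [c] lies in the left coset [t H]. Infinite index
    enters the induction below in the form that no finite list covers. *)
Definition covers H T := forall c, exists2 t, t \in T & H (t^-1 * c).

Lemma cofinite_index H T : subgroup H -> covers H T -> finite_index H.
Proof.
move=> sH cH; apply: (@sub_finite_set _ _
  ((fun g : G => [set g * h | h in H])%classic @` [set` T])%classic).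
  move=> _ [g _ <-]; have [t tT Ht] := cH g; exists t => //.
  rewrite eqEsubset; split=> _ [h Hh <-] /=.
    exists (g^-1 * t * h); last by rewrite !mulgA mulgV mul1g.
    apply: subgroupM => //; have -> : g^-1 * t = (t^-1 * g)^-1 by rewrite invgM invgK.
    exact: subgroupV.
  exists (t^-1 * g * h); last by rewrite !mulgA mulgV mul1g.
  exact: subgroupM.
by apply: finite_image; apply: finite_seq.
Qed.

(* Induction on the number of subgroups: if some coset c K avoids the finitely
   many cosets of K in the cover, then c K, and with it every coset of K, is
   covered by finitely many cosets of the other subgroups. *)
Lemma neumann_covering (Ks : seq (set G)) T :
  (forall K, K \in Ks -> subgroup K /\ forall T', ~ covers K T') ->
  exists c, forall K t, K \in Ks -> t \in T -> ~ K (t^-1 * c).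
Proof.
elim: Ks T => [|K Ks IH] T HK; first by exists 1.
have [sK /(_ T) /existsNP [c0 Hc0]] := HK K (mem_head _ _).
have HKs K' : K' \in Ks -> subgroup K' /\ forall T', ~ covers K' T'.
  by move=> K'i; apply: HK; rewrite in_cons K'i orbT.
(* If [c] lies in [t1 K], the witness becomes [c0 * t1^-1 * c], which lies in [c0 K] and so in no
   [t K]. The products in [T1] keep it out of the cosets of the other subgroups. *)
pose T1 := T ++ [seq t1 / c0 * t2 | t1 <- T, t2 <- T].
have [c Hc] := IH T1 HKs.
have [[t1 t1T K1]|NK] := pselect (exists2 t, t \in T & K (t^-1 * c)); last first.
  exists c => K' t; rewrite in_cons => /orP[/eqP ->|K'i] tT; first by move=> Kt; apply: NK; exists t.
  by apply: Hc => //; rewrite mem_cat tT.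
exists (c0 * t1^-1 * c) => K' t; rewrite in_cons => /orP[/eqP ->|K'i] tT.
  move=> Kt; apply: Hc0; exists t => //.
  have -> : t^-1 * c0 = (t^-1 * (c0 * t1^-1 * c)) / (t1^-1 * c).
    by rewrite invgM invgK !mulgA mulgK mulgVK.
  exact: subgroupF.
move=> Kt; apply: (Hc K' (t1 / c0 * t)) => //.
  by rewrite mem_cat; apply/orP; right; apply/allpairsP; exists (t1, t).
by rewrite !invgM !invgK -!mulgA; rewrite -!mulgA in Kt.
Qed.

(** The set [x H y] is the left coset by [x y] of the conjugate [y^-1 H y], and conjugates of [H]
    have infinite index too, so Neumann's lemma applies. *)
Lemma not_covered_double H (S T : seq G) :
  subgroup H -> ~ finite_index H ->
  exists c, forall x y h, x \in S -> y \in T -> H h -> c <> x * h * y.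
Proof.
move=> sH iH.
have [|c Hc] := @neumann_covering [seq [set x | H (y * x * y^-1)]%classic | y <- T]
  [seq x * y | x <- S, y <- T].
  move=> K /mapP [y _ ->]; split.
    apply: subgroupP => /=; first by rewrite mulg1 mulgV; apply: subgroup1.
    move=> a b Ha Hb; have -> : y * (a / b) / y = (y * a / y) / (y * b / y).
      by rewrite !invgM !invgK !mulgA mulgVK.
    exact: subgroupF.
  move=> T' cT; apply: iH; apply: (@cofinite_index _ [seq t * y^-1 | t <- T']) => // c.
  have [t tT Ht] := cT (c * y); exists (t / y); first exact: map_f.
  by rewrite invgM invgK; move: Ht => /=; rewrite !mulgA mulgK.
exists c => x y h xS yT Hh E.
apply: (Hc [set x | H (y * x * y^-1)]%classic (x * y)).
- by apply/mapP; exists y.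
- by apply/allpairsP; exists (x, y).
- by rewrite /= E !invgM !mulgA mulgK mulgV mul1g mulVg mul1g.
Qed.

End Neumann.

(** * Hyperbolic metrics and the Morse lemma *)

Section HyperbolicMetric.
Variables (X : Type) (d : X -> X -> nat) (delta : nat).

(** The last field is Gromov's four-point condition; its [delta] is twice the constant in the
    inequality for Gromov products. *)
Record hyperbolic_metric : Prop := HyperbolicMetric {
  dist_refl : forall x, d x x = 0;
  dist_sym : forall x y, d x y = d y x;
  dist_tri : forall x y z, d x z <= d x y + d y z;
  dist_four : forall x y z w,
    d x z + d y w <= maxn (d x y + d z w) (d x w + d y z) + delta }.

(* Twice the Gromov product of x and y based at v is at most C. *)
Definition btw C x v y := d x v + d v y <= d x y + C.

Hypothesis hyp_d : hyperbolic_metric.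

Let dC := dist_sym hyp_d.
Let dT := dist_tri hyp_d.
Let d4 := dist_four hyp_d.

Lemma btw_sym C x v y : btw C x v y = btw C y v x.
Proof. by rewrite /btw addnC (dC y v) (dC v x) (dC x y). Qed.

Lemma btw_le C C' x v y : C <= C' -> btw C x v y -> btw C' x v y.
Proof. rewrite /btw; lia. Qed.

Lemma btw_perturb C U x v y x' v' y' : d x x' <= U -> d v v' <= U -> d y y' <= U ->
  btw C x v y -> btw (C + 6 * U) x' v' y'.
Proof.
rewrite /btw => hx hv hy h.
move: (dT x' x v') (dT x v v') (dT v' v y') (dT v y y') (dT x x' y) (dT x' y' y).
by rewrite (dC x' x) (dC v' v) (dC y' y); lia.
Qed.

(** The four-point condition read at [v]: the Gromov product of [x] and [y] is, up to an error, at
    least the minimum of those of [x, z] and [z, y]. *)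
Lemma btw_or C x v y z : btw C x v y -> btw (C + delta) x v z || btw (C + delta) z v y.
Proof.
rewrite /btw => h; move: (d4 x z y v) (dC v y) (dC z v); lia.
Qed.

(** The long segment from [p1] to [p2] rules out one term of the maximum in the four-point
    condition. The new constant depends on [C] but not on [C'], so errors do not accumulate under
    iteration. *)
Lemma btw_chain C C' p0 p1 p2 p3 : btw C p0 p1 p2 -> btw C' p1 p2 p3 ->
  C + C' + delta < (d p1 p2).*2 -> btw (C + delta) p0 p1 p3.
Proof.
rewrite /btw => h1 h2 h; move: (d4 p0 p1 p2 p3); lia.
Qed.

Lemma btw_close C C' E x y p q : btw C x p y -> btw C' x q y ->
  d x p <= d x q + E -> d x q <= d x p + E -> d p q <= C + C' + E + delta.
Proof.
rewrite /btw => h1 h2 h3 h4; move: (d4 x p y q) (dC y q); lia.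
Qed.

(** Each halving of the index interval costs one [delta], by [btw_or] at the midpoint. This is the
    source of the logarithm in the Morse lemma. *)
Lemma btw_dyadic (p : nat -> X) v C k a : btw C (p a) v (p (a + 2 ^ k)) ->
  exists i, btw (C + k * delta) (p i) v (p i.+1).
Proof.
elim: k C a => [|k IH] C a h; first by exists a; rewrite addn0 -addn1.
have := btw_or (p (a + 2 ^ k)) h; rewrite expnS mul2n -addnn addnA.
by case/orP=> /IH [i hi]; exists i; move: hi; rewrite mulSn addnA.
Qed.

End HyperbolicMetric.

Lemma linear_lt_exp a b : exists k0, forall k, k0 <= k -> a * k + b < 2 ^ k.
Proof.
pose m := (a + b).+1; exists (3 * m) => k /subnK <-; elim: (k - 3 * m) => [|j IH].
  have h : m < 2 ^ m by apply: ltn_expl.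
  rewrite add0n mulnC expnM (_ : 2 ^ 3 = 8) //.
  have : m.+1 ^ 3 <= (2 ^ m) ^ 3 by rewrite leq_exp2r.
  by rewrite -expnM mulnC expnM !expnS expn0 /m; nia.
by rewrite addSn expnS; move: IH; set t := 2 ^ _; rewrite /m; nia.
Qed.

(* In the Morse lemma, D is the distance from a point of the geodesic to the
   path and [c * (6 * D)] bounds the length of the stretch of path cut off. *)
Lemma log_bound B c delta : exists D0, forall D, D0 < D ->
  exists2 k, c * (6 * D) <= 2 ^ k & B + (k + 2) * delta < D.*2.
Proof.
have [k0 hk] := linear_lt_exp (c * 3 * delta) (c * 3 * (B + 3 * delta)).
exists (B + (k0 + 3) * delta) => D hD.
have [h0|h0] := leqP (c * (6 * D)) (2 ^ k0); first by exists k0 => //; nia.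
have : exists k, c * (6 * D) <= 2 ^ k by exists (c * (6 * D)); apply/ltnW/ltn_expl.
move=> /ex_minnP [[|k] hk1 hmin].
  by exists 0 => //; nia.
exists k.+1 => //.
have h2 : 2 ^ k < c * (6 * D) by rewrite ltnNge; apply/negP => /hmin; rewrite ltnn.
have k0k : k0 <= k.
  by rewrite leqNgt; apply/negP => kk0; move: (leq_pexp2l (isT : 0 < 2) kk0); lia.
move: (hk _ k0k) => h3; rewrite ltnNge; apply/negP => h4.
have : c * 3 * D.*2 <= c * 3 * (B + (k.+1 + 2) * delta) by rewrite leq_mul2l h4 orbT.
by move: h3 h2; rewrite -muln2; nia.
Qed.

Section Morse.
Variables (X : Type) (d : X -> X -> nat) (delta : nat).
Hypothesis hyp_d : hyperbolic_metric d delta.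

Let dC := dist_sym hyp_d.
Let dT := dist_tri hyp_d.

Definition discrete_geodesic (N : nat) (g : nat -> X) :=
  forall i j, i <= j <= N -> d (g i) (g j) = j - i.

Lemma path_near_point (p : nat -> X) a b v k m B C :
  (forall i, a <= i < b -> d (p i) (p i.+1) <= B) -> a <= b -> b - a <= 2 ^ k ->
  (forall i, a <= i <= b -> m <= d (p i) v) ->
  btw d C (p a) v (p b) -> m.*2 <= B + C + k * delta.
Proof.
move=> hB ab hk hm h.
(* The path is padded with its last point to exactly [2 ^ k] steps; a consecutive pair found in the
   padding is [p b] twice. *)
pose q j := p (minn (a + j) b).
have : btw d C (q 0) v (q (0 + 2 ^ k)).
  by rewrite /q addn0 (minn_idPl ab) (minn_idPr _) //; lia.
case/(btw_dyadic hyp_d) => j; rewrite /btw /q.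
have := hm (minn (a + j) b); have := hm (minn (a + j.+1) b).
rewrite (dC v) => h1 h2 h3.
have [jb|jb] := ltnP (a + j) b.
  have E1 : minn (a + j) b = a + j by lia.
  have E2 : minn (a + j.+1) b = (a + j).+1 by lia.
  by move: h1 h2 h3 (hB (a + j)); rewrite E1 E2; lia.
have E1 : minn (a + j) b = b by lia.
have E2 : minn (a + j.+1) b = b by lia.
move: h1 h3; rewrite E1 E2 (dist_refl hyp_d); lia.
Qed.

Lemma path_near_point_sym (p : nat -> X) n a b v k m B C :
  (forall i, i < n -> d (p i) (p i.+1) <= B) -> a <= n -> b <= n ->
  b - a <= 2 ^ k -> a - b <= 2 ^ k -> (forall i, i <= n -> m <= d (p i) v) ->
  btw d C (p a) v (p b) -> m.*2 <= B + C + k * delta.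
Proof.
move=> hB an bn k1 k2 hm h; have [ab|/ltnW ba] := leqP a b.
  by apply: path_near_point h => // i hi; [apply: hB | apply: hm]; lia.
rewrite (btw_sym hyp_d) in h.
by apply: path_near_point h => // i hi; [apply: hB | apply: hm]; lia.
Qed.

(* At a point v of the geodesic at maximal distance D from the path p, jump from
   the points of the geodesic at distance 2D on either side of v to p; the
   stretch of p cut off has length linear in D and stays at distance D from v,
   whereas being near a geodesic through v would bound D by a logarithm. *)
Lemma morse B c : exists D, forall (p g : nat -> X) n N,
  (forall i, i < n -> d (p i) (p i.+1) <= B) ->
  (forall i j, i <= j <= n -> j - i <= c * d (p i) (p j)) ->
  discrete_geodesic N g -> g 0 = p 0 -> g N = p n ->
  forall s, s <= N -> exists2 i, i <= n & d (g s) (p i) <= D.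
Proof.
have [D0 HD0] := log_bound B c delta; exists (D0 + delta) => p g n N hB hc hg g0 gN.
pose f s := d (g s) (p [arg min_(i < (ord0 : 'I_n.+1)) d (g s) (p i)]).
have fP s : exists2 i, i <= n & d (g s) (p i) = f s.
  by exists [arg min_(i < (ord0 : 'I_n.+1)) d (g s) (p i)] => //; rewrite -ltnS.
have fmin s i : i <= n -> f s <= d (g s) (p i).
  move=> hi; rewrite /f; case: arg_minnP => // j _ /(_ (inord i) isT).
  by rewrite inordK.
pose m := [arg max_(s > (ord0 : 'I_N.+1)) f s]; pose D := f m.
have fmax s : s <= N -> f s <= D.
  move=> hs; rewrite /D /m; case: arg_maxnP => // j _ /(_ (inord s) isT).
  by rewrite /= inordK.
suff DD0 : D <= D0 + delta.
  by move=> s hs; have [i hi e] := fP s; exists i => //; rewrite e (leq_trans (fmax _ hs)).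
rewrite leqNgt; apply/negP => hD.
have [|k hk1 hk2] := HD0 D; first lia.
have mN : m <= N by rewrite -ltnS.
have hm i : i <= n -> D <= d (p i) (g m) by rewrite dC; apply: fmin.
(* Subtraction truncates: if [m <= D.*2], the left point is [g 0], which is on the path, and [a] is
   then 0. The right point is likewise clamped to [g N]. *)
have [a an [ha1 ha2]] : exists2 a, a <= n &
    d (g (m - D.*2)) (p a) <= D /\ (m - D.*2 = m - m -> a = 0).
  have [h|h] := leqP m D.*2.
    by exists 0 => //; split=> //; rewrite (eqP h) g0 (dist_refl hyp_d).
  have [a an e] := fP (m - D.*2); exists a => //; split; last lia.
  by rewrite e fmax //; lia.
have [b bn [hb1 hb2]] : exists2 b, b <= n &
    d (g (minn N (m + D.*2))) (p b) <= D /\ (minn N (m + D.*2) = N -> b = n).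
  have [h|h] := leqP N (m + D.*2).
    by exists n => //; rewrite gN (dist_refl hyp_d).
  have [b bn e] := fP (m + D.*2); exists b => //; split; last lia.
  by rewrite e fmax //; lia.
have da : d (g (m - D.*2)) (g m) = m - (m - D.*2) by apply: hg; lia.
have db : d (g m) (g (minn N (m + D.*2))) = minn N (m + D.*2) - m by apply: hg; lia.
have dab : d (g (m - D.*2)) (g (minn N (m + D.*2))) = minn N (m + D.*2) - (m - D.*2).
  by apply: hg; lia.
have h0 : btw d 0 (g (m - D.*2)) (g m) (g (minn N (m + D.*2))) by rewrite /btw da db dab; lia.
(* The ends of the stretch of geodesic are replaced by [p a] and then [p b]. The discarded
   alternatives would give [D <= delta], which is why [delta] is added to [D0]. *)
case/orP: (btw_or hyp_d (p a) h0) => [h1|].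
  have [h|h] : m <= D.*2 \/ D.*2 < m by lia.
    have E : m - D.*2 = 0 by lia.
    have a0 : a = 0 by apply: ha2; lia.
    have dm : d (p 0) (g m) = m by rewrite -g0 hg // subn0.
    by move: h1 (hm _ an); rewrite /btw da a0 E g0 (dist_refl hyp_d) (dC (g m)) dm; lia.
  by move: h1 (hm _ an); rewrite /btw da (dC (g m)); lia.
move=> h1; case/orP: (btw_or hyp_d (p b) h1) => [h2|].
  have pab : d (p a) (p b) <= 6 * D.
    move: (dT (p a) (g (m - D.*2)) (p b)) (dT (g (m - D.*2)) (g (minn N (m + D.*2))) (p b)).
    by rewrite dab (dC (p a) (g _)); lia.
  have kab : c * d (p a) (p b) <= 2 ^ k by apply: leq_trans hk1; rewrite leq_mul2l pab orbT.
  have := path_near_point_sym hB an bn _ _ hm h2 (k := k).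
  have h3 : b - a <= 2 ^ k.
    by have [ab|] := leqP a b; [apply: leq_trans kab; apply: hc; lia | lia].
  have h4 : a - b <= 2 ^ k.
    by have [ab|] := leqP b a; [apply: leq_trans kab; rewrite dC; apply: hc; lia | lia].
  by move=> /(_ h3 h4); move: hk2; lia.
have [h|h] : N <= m + D.*2 \/ m + D.*2 < N by lia.
  have E : minn N (m + D.*2) = N by lia.
  have dm : d (p n) (g m) = N - m by rewrite -gN dC hg //; lia.
  by move: (hm _ bn); rewrite /btw db hb2 // E gN (dist_refl hyp_d) dm; lia.
by move: (hm _ bn) hb1; rewrite /btw db (dC (g (minn _ _)) (p b)); lia.
Qed.

End Morse.

(** * Chains and loxodromic elements *)

Section GroupLength.
Local Open Scope group_scope.
Variables (G : groupType) (l : G -> nat) (delta : nat).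

Definition dist (x y : G) := l (x^-1 * y).

Record hyperbolic_length : Prop := HyperbolicLength {
  len_metric : hyperbolic_metric dist delta;
  len_geodesic : forall g, exists c : nat -> G,
    [/\ c 0%N = 1, c (l g) = g & discrete_geodesic dist (l g) c];
  len_ball : forall n, exists s : seq G, forall g, l g <= n -> g \in s }.

Hypothesis hyp_l : hyperbolic_length.
Let hyp_d := len_metric hyp_l.

Lemma len1 : l 1 = 0%N.
Proof. by rewrite -(dist_refl hyp_d 1) /dist mulVg. Qed.

Lemma lenV x : l x^-1 = l x.
Proof. by have := dist_sym hyp_d x 1; rewrite /dist mulg1 invg1 mul1g. Qed.

Lemma lenM x y : l (x * y) <= l x + l y.
Proof.
by have := dist_tri hyp_d x^-1 1 y; rewrite /dist invgK invg1 mulg1 mul1g.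
Qed.

Lemma dist1g x : dist 1 x = l x.
Proof. by rewrite /dist invg1 mul1g. Qed.

Lemma distg1 x : dist x 1 = l x.
Proof. by rewrite (dist_sym hyp_d) dist1g. Qed.

Lemma distM g x y : dist (g * x) (g * y) = dist x y.
Proof. by rewrite /dist invgM -mulgA mulKg. Qed.

Lemma dist_mulr x g : dist x (x * g) = l g.
Proof. by rewrite /dist mulKg. Qed.

Lemma dist_mull x g : dist (x * g) x = l g.
Proof. by rewrite (dist_sym hyp_d) dist_mulr. Qed.

Lemma btwM g C x v y : btw dist C (g * x) (g * v) (g * y) = btw dist C x v y.
Proof. by rewrite /btw !distM. Qed.

(** Little cancels in [a * b]: twice the Gromov product of [a^-1] and [b] at the identity is at most
    [C]. *)
Definition link C a b := l a + l b <= l (a * b) + C.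

Lemma btw1_link C a b : btw dist C a 1 b = link C a^-1 b.
Proof. by rewrite /btw /link distg1 dist1g lenV. Qed.

Lemma btw_link C x a b : btw dist C x (x * a) (x * a * b) = link C a b.
Proof. by rewrite /btw /link !dist_mulr -mulgA dist_mulr. Qed.

Lemma linkV C a b : link C b^-1 a^-1 = link C a b.
Proof. by rewrite /link -invgM !lenV addnC. Qed.

Lemma link_le C C' a b : C <= C' -> link C a b -> link C' a b.
Proof. rewrite /link; lia. Qed.

Lemma link_or C a b c : link C a b -> link (C + delta) a c || link (C + delta) c^-1 b.
Proof.
have := @btw_or _ _ _ hyp_d C a^-1 1 b c.
by rewrite !btw1_link !invgK.
Qed.

Lemma link_chain C C' a b c : link C a b -> link C' b c ->
  C + C' + delta < (l b).*2 -> link (C + delta) a (b * c).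
Proof.
rewrite -(btw_link C 1) -(btw_link C' (1 * a)) => h1 h2 h3.
have := btw_chain hyp_d h1 h2; rewrite dist_mulr => /(_ h3).
by rewrite -mulgA btw_link.
Qed.

Definition prodg (s : seq G) := \prod_(x <- s) x.

Lemma prodg_cons x s : prodg (x :: s) = x * prodg s.
Proof. by rewrite /prodg big_cons. Qed.

Lemma prodg_nil : prodg [::] = 1.
Proof. by rewrite /prodg big_nil. Qed.

Lemma prodg_cat s t : prodg (s ++ t) = prodg s * prodg t.
Proof. by rewrite /prodg big_cat. Qed.

Lemma prodg_nseq n x : prodg (nseq n x) = x ^+ n.
Proof. by elim: n => [|n IH]; rewrite /= ?prodg_nil // prodg_cons IH expgS. Qed.

Section Chains.
Variables C L : nat.

Definition chain (s : seq G) := sorted (link C) s && all (fun x => L <= l x) s.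

Lemma chain_cat s t : chain (s ++ t) -> chain s /\ chain t.
Proof.
rewrite /chain all_cat; case: s => [|a s] //=; rewrite cat_path => /and3P[/andP[-> h] ->].
by case: t h => [|b t] //= /andP[_ ->] ->.
Qed.

(** Induction on the tail: in [link_chain] the overlap of [b] with the remaining factors affects
    only the length condition, so the loss stays at one [delta] for any number of factors. *)
Lemma link_left a s : C + delta < L -> chain (a :: s) -> link (C + delta) a (prodg s).
Proof.
move=> hL; elim: s a => [|b s IH] a.
  by rewrite prodg_nil /link mulg1 len1; lia.
move=> h; rewrite prodg_cons; have [_ /IH h2] := @chain_cat [:: a] _ h.
move: h; rewrite /chain /= => /andP[/andP[h1 _]] /and3P[_ hb _].
by apply: link_chain h1 h2 _; lia.
Qed.

Lemma link_right b s : C + delta < L -> chain (rcons s b) -> link (C + delta) (prodg s) b.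
Proof.
move=> hL; elim/last_ind: s b => [|s a IH] b.
  by rewrite prodg_nil /link mul1g len1; lia.
rewrite -cats1 => h; have [/IH h1 _] := chain_cat h.
have {h} := h; rewrite -cats1 -catA => /chain_cat [_].
rewrite /chain /= andbT => /andP[h2] /and3P[ha _ _].
rewrite prodg_cat prodg_cons prodg_nil mulg1 -linkV invgM.
apply: (@link_chain _ (C + delta)); rewrite ?linkV ?lenV //; lia.
Qed.

Lemma link_split s t : C + delta.*2 < L -> chain (s ++ t) ->
  link (C + delta.*2) (prodg s) (prodg t).
Proof.
move=> hL; case: t => [|b t]; first by rewrite prodg_nil /link mulg1 len1; lia.
move=> h; have [_ h1] := chain_cat h.
have {h1} h1 : link (C + delta) b (prodg t) by apply: link_left h1; lia.
move: h; rewrite -cat_rcons => /chain_cat [h _].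
have hb : L <= l b by move: h; rewrite /chain all_rcons => /and3P[].
have {}h : link (C + delta) (prodg s) b by apply: link_right h; lia.
rewrite prodg_cons -addnn addnA; apply: link_chain h h1 _; lia.
Qed.

Lemma len_chain s : C + delta < L -> chain s -> size s <= l (prodg s).
Proof.
move=> hL; elim: s => [|a s IH] // h; have h1 := link_left hL h.
have [ha /IH h2] := @chain_cat [:: a] _ h.
move: ha h1; rewrite prodg_cons /chain /link /=; lia.
Qed.

End Chains.

(** The thresholds make every list [g, ..., g] a chain to which [link_split] applies with
    [C = 4 * delta]; hence the powers of [g] grow at least linearly. *)
Definition loxodromic g := link (4 * delta) g g && (6 * delta < l g).

Lemma loxodromicV g : loxodromic g -> loxodromic g^-1.
Proof. by rewrite /loxodromic linkV lenV. Qed.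

Lemma chain_nseq g n : loxodromic g -> chain (4 * delta) (6 * delta).+1 (nseq n g).
Proof.
case/andP=> h1 h2; rewrite /chain all_nseq h2 orbT andbT.
by case: n => //= n; elim: n => //= n ->; rewrite h1.
Qed.

Lemma lox_link g m n : loxodromic g -> link (6 * delta) (g ^+ m) (g ^+ n).
Proof.
move=> hg; rewrite -!prodg_nseq; apply: (@link_le (4 * delta + delta.*2)); first lia.
by apply: (@link_split _ (6 * delta).+1); [lia | rewrite -nseqD; exact: chain_nseq].
Qed.

Lemma lox_len g n : loxodromic g -> n <= l (g ^+ n).
Proof.
move=> /(chain_nseq n) /len_chain; rewrite prodg_nseq size_nseq; apply; lia.
Qed.

(* If neither half a, b of a long geodesic word is loxodromic then a starts like
   its inverse, and so does b; since a^-1 and b diverge, so do a and b^-1, whence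
   the product a b is loxodromic. *)
Lemma exists_loxodromic : (forall T : seq G, exists c, c \notin T) ->
  exists g, loxodromic g.
Proof.
move=> infG; pose m := (6 * delta).+1.
have [s hs] := len_ball hyp_l m.*2; have [c hc] := infG s.
have {s hs hc} hc : m.*2 <= l c.
  by rewrite leqNgt; apply/negP => h; move/negP: hc; apply; apply: hs; lia.
have [p [p0 _ hp]] := len_geodesic hyp_l c.
pose a := p m; pose b := a^-1 * p m.*2.
have la : l a = m by rewrite -dist1g -p0 hp ?subn0 //; lia.
have lb : l b = m by rewrite /b -/(dist a _) hp; lia.
have lab : l (a * b) = m.*2 by rewrite /b mulVKg -dist1g -p0 hp ?subn0 //; lia.
have h0 : link 0 a b by rewrite /link la lb lab; lia.
have [ga|nga] := boolP (loxodromic a); first by exists a.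
have [gb|ngb] := boolP (loxodromic b); first by exists b.
exists (a * b); rewrite /loxodromic lab andbC; apply/andP; split; first by rewrite /m; lia.
have na : ~~ link (4 * delta) a a by move: nga; rewrite /loxodromic la /m ltnSn andbT.
have nb : ~~ link (4 * delta) b b by move: ngb; rewrite /loxodromic lb /m ltnSn andbT.
have h1 : link delta a^-1 b.
  by case/orP: (link_or a h0) => // /(@link_le _ (4 * delta)) h; move: na; rewrite h //; lia.
have h2 : link (delta + delta) a^-1 b^-1.
  case/orP: (link_or b^-1 h1) => //; rewrite invgK => /(@link_le _ (4 * delta)) h.
  by move: nb; rewrite h //; lia.
have {}h2 : link (delta + delta) b a by rewrite -linkV.
have -> : (a * b) = prodg [:: a; b] by rewrite !prodg_cons prodg_nil mulg1.
apply: (@link_le (2 * delta + delta.*2)); first lia.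
apply: (@link_split _ m); first by rewrite /m; lia.
rewrite /chain /= la lb !leqnn !andbT; apply/and3P; split.
- by apply: link_le h0.
- by apply: link_le h2; lia.
- by apply: link_le h0.
Qed.

Definition orbit_const g C := C + 6 * delta + l g + delta.

(** The exponent [i] is the largest one with [g ^+ i] no longer than [v]. If [i < n], the next power
    is longer, so the lengths differ by less than [l g], and [btw_close] applies. *)
Lemma orbit_close g C v n : loxodromic g -> btw dist C 1 v (g ^+ n) ->
  exists2 i, i <= n & dist v (g ^+ i) <= orbit_const g C.
Proof.
move=> hg h.
have ex0 : exists i, (i <= n) && (l (g ^+ i) <= l v) by exists 0%N; rewrite expg0 len1.
have ub i : (i <= n) && (l (g ^+ i) <= l v) -> i <= n by case/andP.
case: (ex_maxnP ex0 ub) => i /andP[ilen hi] imax; exists i => //.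
have hig : btw dist (6 * delta) 1 (g ^+ i) (g ^+ n).
  by rewrite -(subnKC ilen) expgnDr -[g ^+ i]mul1g btw_link lox_link.
have [eq_in|ltin] : i = n \/ i < n by lia.
  by move: h hi; rewrite /btw /orbit_const eq_in dist1g dist1g; lia.
apply: (btw_close hyp_d h hig); rewrite !dist1g; last lia.
rewrite leqNgt; apply/negP => hlt; have := imax i.+1; rewrite ltnn ltin /=.
have h1 := lenM (g ^+ i) g; rewrite -expgSr in h1; by move/(_ (leq_trans h1 (ltnW hlt))).
Qed.

(** The points [g ^+ (a * k) * t = t * g' ^+ (b * k)] show that [t] lies nearly between far points
    of the orbit of [g]. The bound on [y] does not depend on [t]. *)
Lemma near_axis g g' t a b (K : set G) : loxodromic g -> loxodromic g' ->
  subgroup K -> K g -> 0 < a -> 0 < b -> g ^+ a * t = t * g' ^+ b ->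
  exists z y, [/\ K z, l y <= orbit_const g (8 * delta) & t = z * y].
Proof.
move=> hg hg' sK Kg a0 b0 E.
have Ek k : g ^+ (a * k) * t = t * g' ^+ (b * k).
  elim: k => [|k IH]; first by rewrite !muln0 !expg0 mulg1 mul1g.
  by rewrite !mulnS !expgnDr -mulgA IH mulgA E mulgA.
have EkV k : g ^- (a * k) * t = t * g' ^- (b * k).
  by apply: (mulgI (g ^+ (a * k))); rewrite mulVKg mulgA Ek -mulgA mulgV mulg1.
(* The ends [t * g' ^- (b * k)] and [t * g' ^+ (b * k)] are at distance [l t] from powers of [g].
   This [k] is large enough to replace them by those powers, at a cost of [delta] each. *)
pose k := (l t + 8 * delta).+1.
have far x : k <= x -> l t + 8 * delta < x by [].
have lb : l t + 8 * delta < l (g' ^+ (b * k)).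
  by apply: far; apply: leq_trans (lox_len _ hg'); rewrite leq_pmull.
have h0 : btw dist (6 * delta) (t * g' ^- (b * k)) t (t * g' ^+ (b * k)).
  by rewrite -{2}[t]mulg1 btwM btw1_link invgK lox_link.
have h1 : btw dist (6 * delta + delta) (g ^- (a * k)) t (t * g' ^+ (b * k)).
  case/orP: (btw_or hyp_d (g ^- (a * k)) h0) => //.
  rewrite /btw dist_mull lenV -EkV dist_mull; lia.
have h2 : btw dist (6 * delta + delta + delta) (g ^- (a * k)) t (g ^+ (a * k)).
  case/orP: (btw_or hyp_d (g ^+ (a * k)) h1) => //.
  rewrite /btw dist_mulr -Ek dist_mulr; lia.
have h3 : btw dist (8 * delta) 1 (g ^+ (a * k) * t) (g ^+ (a * k + a * k)).
  rewrite -(mulgV (g ^+ (a * k))) expgnDr btwM; apply: btw_le h2; lia.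
have [i _ hi] := orbit_close hg h3.
exists (g ^- (a * k) * g ^+ i), (g ^- i * (g ^+ (a * k) * t)); split.
- by apply: subgroupM => //; [apply: subgroupV => //|]; apply: subgroupX.
- by rewrite -/(dist _ _) (dist_sym hyp_d).
- by rewrite -mulgA mulVKg mulKg.
Qed.

(* If the Gromov products are unbounded, many points g^i are close to points
   t h^j, and two of the differences g^-i t h^j coincide. *)
Lemma diverge_or_commensurate g h t : loxodromic g -> loxodromic h ->
  (exists C, forall m n, btw dist C (g ^+ m) 1 (t * h ^+ n)) \/
  (exists a b, [/\ 0 < a, 0 < b &
     g ^+ a * t = t * h ^+ b \/ g ^+ a * t = t * h^-1 ^+ b]).
Proof.
move=> hg hh; pose R := orbit_const h (7 * delta + (l t).*2).
have [s hs] := len_ball hyp_l R; pose M := (size s).+1.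
have [|hC] := pselect (exists C, forall m n, btw dist C (g ^+ m) 1 (t * h ^+ n)); first by left.
(* The overlap is taken so large that every [g ^+ i] with [i < M] lies near the stretch shared with
   the path to [t * h ^+ n]. *)
right; have {hC} [m [n hmn]] : exists m n,
    ~~ btw dist (7 * delta + 2 * (M * l g)) (g ^+ m) 1 (t * h ^+ n).
  apply: contrapT => hno; apply: hC; exists (7 * delta + 2 * (M * l g))%N => m n.
  by apply: contrapT => hmn; apply: hno; exists m, n; apply/negP.
have lgi i : l (g ^+ i) <= i * l g.
  elim: i => [|i IH]; first by rewrite expg0 len1.
  by rewrite expgS mulSn (leq_trans (lenM _ _)) // leq_add2l.
have Mm : M <= m.
  rewrite leqNgt; apply/negP => mM; move: hmn; rewrite /btw distg1 dist1g -ltnNge.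
  have : m * l g <= M * l g by rewrite leq_mul2r ltnW ?orbT.
  move: (lgi m) (dist_tri hyp_d 1 (g ^+ m) (t * h ^+ n)); rewrite !dist1g; lia.
have close i : exists j, i < M -> g ^- i * t * h ^+ j \in s.
  have [iM|] := ltnP i M; last by exists 0%N; lia.
  have h0 : btw dist (6 * delta) 1 (g ^+ i) (g ^+ m).
    by rewrite -(subnKC (leq_trans (ltnW iM) Mm)) expgnDr -[g ^+ i]mul1g btw_link lox_link.
  have {h0} h1 : btw dist (6 * delta + delta) 1 (g ^+ i) (t * h ^+ n).
    case/orP: (btw_or hyp_d (t * h ^+ n) h0) => // h1; exfalso; move: hmn h1.
    rewrite /btw distg1 dist1g (dist_sym hyp_d (t * h ^+ n)) (dist_sym hyp_d (t * h ^+ n)).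
    have : i * l g <= M * l g by rewrite leq_mul2r ltnW ?orbT.
    move: (lgi i) (dist_tri hyp_d 1 (g ^+ i) (t * h ^+ n)) (dist_tri hyp_d 1 (g ^+ i) (g ^+ m)).
    rewrite !dist1g; lia.
  have {h1} h2 : btw dist (7 * delta + (l t).*2) t (g ^+ i) (t * h ^+ n).
    move: h1 (dist_tri hyp_d t 1 (g ^+ i)) (dist_tri hyp_d 1 t (t * h ^+ n)).
    by rewrite /btw distg1 !dist1g; lia.
  rewrite -[X in btw _ _ X]mulg1 -(mulVKg t (g ^+ i)) btwM in h2.
  have [j _ hj] := orbit_close hh h2; exists j => _; apply: hs.
  by move: hj; rewrite /dist invgM invgK.
have [j hj] := choice close.
have ninj : ~~ uniq [seq g ^- i * t * h ^+ j i | i <- iota 0 M].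
  apply/negP => hu; have := uniq_leq_size hu (s2 := s); rewrite size_map size_iota ltnn => hf.
  have hs2 : {subset [seq g ^- i * t * h ^+ j i | i <- iota 0 M] <= s}.
    by move=> x /mapP [i]; rewrite mem_iota add0n => iM ->; apply: hj.
  by have := hf hs2.
have [i [i' [ii' E]]] : exists i i', i < i' /\
    g ^- i * t * h ^+ j i = g ^- i' * t * h ^+ j i'.
  apply: contrapT => hno; move/negP: ninj; apply; rewrite map_inj_uniq ?iota_uniq //.
  move=> i i' E; have [ii'|ii'|//] := ltngtP i i'.
    by case: hno; exists i, i'.
  by case: hno; exists i', i.
have {}E : g ^+ (i' - i) * t * h ^+ j i = t * h ^+ j i'.
  apply: (mulgI (g ^- i')); rewrite !mulgA -E; congr (_ * _ * _).
  by apply: (mulgI (g ^+ i')); rewrite mulVKg expgnFr // ltnW.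
have [jj|jj|jj] := ltngtP (j i) (j i').
- exists (i' - i)%N, (j i' - j i)%N; split; rewrite ?subn_gt0 //; left.
  apply: (mulIg (h ^+ j i)); rewrite E -[RHS]mulgA -expgnDr subnK //; exact: ltnW.
- exists (i' - i)%N, (j i - j i')%N; split; rewrite ?subn_gt0 //; right.
  apply: (mulIg (h ^+ j i)); rewrite E -[RHS]mulgA expVgn.
  by rewrite -{2}(subnK (ltnW jj)) expgnDr mulKg.
- move: E; rewrite jj => /mulIg E.
  have := lox_len (i' - i) hg; have -> : g ^+ (i' - i) = 1.
    by apply: (mulIg t); rewrite E mul1g.
  by rewrite len1; lia.
Qed.

End GroupLength.

(** * Words and generated subgroups *)

Section Generated.
Local Open Scope group_scope.
Variable G : groupType.

Lemma generated_subgroup (A : set G) : subgroup (generated A).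
Proof.
apply: subgroupP => [K [sK _]|x y Hx Hy K [sK AK]]; first exact: subgroup1.
by apply: subgroupF => //; [apply: Hx | apply: Hy].
Qed.

Lemma generated_sub (A : set G) x : A x -> generated A x.
Proof. by move=> Ax K [_]; apply. Qed.

Lemma generated_min (A K : set G) x :
  subgroup K -> (forall y, A y -> K y) -> generated A x -> K x.
Proof. by move=> sK AK; apply. Qed.

Variables (I : eqType) (b : I -> G).
Implicit Types (ws : seq (I * bool)) (u v : I * bool).

Definition flip u := (u.1, ~~ u.2).

Lemma wv_nil : word_value b [::] = 1.
Proof. by rewrite /word_value big_nil. Qed.

Lemma wv_cons u ws : word_value b (u :: ws) = word_value b [:: u] * word_value b ws.
Proof. by rewrite /word_value !big_cons big_nil mulg1. Qed.

Lemma wv_cat w1 w2 : word_value b (w1 ++ w2) = word_value b w1 * word_value b w2.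
Proof. by rewrite /word_value big_cat. Qed.

Lemma wv_flip u : word_value b [:: flip u] = (word_value b [:: u])^-1.
Proof. by case: u => i [] /=; rewrite /word_value !big_cons !big_nil !mulg1 ?invgK. Qed.

Lemma wvV ws : (word_value b ws)^-1 = word_value b (rev (map flip ws)).
Proof.
elim: ws => [|u ws IH]; first by rewrite wv_nil invg1.
by rewrite wv_cons invgM IH /= rev_cons -cats1 wv_cat wv_flip.
Qed.

Lemma generated_word x : generated (range b) x -> exists ws, x = word_value b ws.
Proof.
apply: (@generated_min _ [set y | exists ws, y = word_value b ws]%classic).
  apply: subgroupP => [|y z [w1 ->] [w2 ->]]; first by exists [::]; rewrite wv_nil.
  by exists (w1 ++ rev (map flip w2)); rewrite wv_cat wvV.
by move=> _ [i _ <-]; exists [:: (i, true)]; rewrite /word_value big_seq1.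
Qed.

Lemma word_generated ws : generated (range b) (word_value b ws).
Proof.
have sF := generated_subgroup (range b).
elim: ws => [|[i e] ws IH]; first by rewrite wv_nil; exact: (subgroup1 sF).
rewrite wv_cons; apply: (subgroupM sF _ IH); rewrite /word_value big_seq1 /=.
have Fi : generated (range b) (b i).
  by have rb : range b (b i) by [exists i]; exact: generated_sub rb.
by case: e => //; exact: (subgroupV sF).
Qed.

Definition noncancelling u v := ~~ ((u.1 == v.1) && (u.2 != v.2)).

Lemma noncancelling_flip u v : noncancelling u v = (v != flip u).
Proof.
case: u v => i e [j f]; rewrite /noncancelling /flip /= xpair_eqE eq_sym.
by congr (~~ (_ && _)); case: e f => [] [].
Qed.

Lemma reduce_step ws : ~~ reduced ws ->
  exists2 ws', size ws' < size ws & word_value b ws' = word_value b ws.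
Proof.
rewrite /reduced; elim: ws => [|u [|v ws] IH] //= ; rewrite negb_and => /orP[|h].
  rewrite -/(noncancelling u v) noncancelling_flip negbK => /eqP ->.
  exists ws; first by rewrite /=; lia.
  by rewrite wv_cons [word_value b (flip u :: _)]wv_cons wv_flip mulVKg.
have [ws' h1 h2] := IH h; exists (u :: ws'); first by rewrite /= ltnS.
by rewrite wv_cons h2 -wv_cons.
Qed.

Lemma reduced_word x : generated (range b) x ->
  exists2 ws, reduced ws & x = word_value b ws.
Proof.
move=> /generated_word [ws ->]; move: {2}(size ws) (leqnn (size ws)) => n.
elim: n ws => [|n IH] ws hn; first by exists ws; case: ws hn.
have [|/reduce_step [ws' h <-]] := boolP (reduced ws); first by exists ws.
by apply: IH; lia.
Qed.

(* An element of minimal word length among the nontrivial elements conjugate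
   into H is represented by a cyclically reduced word. *)
Lemma cyclically_reduced_conjugate (H : set G) x g h :
  generated (range b) x -> x <> 1 -> H h -> x = h ^ g ->
  exists ws g' h', [/\ ws != [::], cycle noncancelling ws, H h' & word_value b ws = h' ^ g'].
Proof.
move=> /generated_word [ws0 ->] x1 Hh E0.
pose P n := `[< exists ws g' h', [/\ size ws = n, word_value b ws <> 1, H h' &
  word_value b ws = h' ^ g'] >].
have exP : exists n, P n by exists (size ws0); apply/asboolP; exists ws0, g, h.
case: (ex_minnP exP) => n /asboolP [ws [g' [h' [sz v1 Hh' E]]]] nmin.
have red ws2 g2 : size ws2 = n -> word_value b ws2 <> 1 ->
    word_value b ws2 = h' ^ g2 -> reduced ws2.
  move=> sz2 v2 E2; apply/negPn/negP => /reduce_step [ws' h1 h2].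
  have : n <= size ws' by apply: nmin; apply/asboolP; exists ws', g2, h'; rewrite h2.
  by rewrite leqNgt -sz2 h1.
case: ws sz v1 E => [|u ws] sz v1 E; first by case: v1; rewrite wv_nil.
exists (u :: ws), g', h'; split => //.
(* The rotated word is a conjugate of the same length, hence also minimal and reduced; its last
   adjacency closes the cycle. *)
have Er : word_value b (rcons ws u) = (word_value b (u :: ws)) ^ (word_value b [:: u]).
  by rewrite -cats1 wv_cat (wv_cons u ws) conjgE -mulgA mulKg.
have h1 := red _ _ sz v1 E.
have h2 : reduced (rcons ws u).
  apply: (red _ (g' * word_value b [:: u])); first by rewrite size_rcons.
    by rewrite Er => /eqP; rewrite conjg_eq1 => /eqP.
  by rewrite Er E conjgM.
move: h1 h2; rewrite /reduced /=; case: ws {sz v1 E Er} => [|v ws] /=.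
  by rewrite /noncancelling !eqxx.
by move=> /andP[h3 _] h4; apply/andP; split.
Qed.

Lemma cycle_nseq_reduced ws n : cycle noncancelling ws -> reduced (flatten (nseq n ws)).
Proof.
case: ws => [|u ws] h; first by elim: n.
suff H m : path noncancelling u (ws ++ flatten (nseq m (u :: ws))).
  by case: n => //= n; exact: H.
elim: m => [|m IH] /=; first by rewrite cats0; move: h; rewrite /= rcons_path => /andP[].
move: h; rewrite /= rcons_path cat_path => /andP[-> h] /=; rewrite h /=.
exact: IH.
Qed.

End Generated.

(** * Construction of the free subgroup *)

Section FreeSubgroup.
Local Open Scope group_scope.
Variables (G : groupType) (l : G -> nat) (delta : nat).
Hypothesis hyp_l : hyperbolic_length l delta.
Let hyp_d := len_metric hyp_l.

(** The elements are chosen one at a time: the next one avoids the finitely many sets [u i x K y]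
    with [x] and [y] in the ball. *)
Lemma separated_representatives (K : set G) R k : subgroup K -> ~ finite_index K ->
  exists u : nat -> G, forall i j x y h, i < j < k -> l x <= R -> l y <= R -> K h ->
    (u i)^-1 * u j <> x * h * y.
Proof.
move=> sK iK; have [s hs] := len_ball hyp_l R.
elim: k => [|k [u hu]]; first by exists (fun _ => 1) => i j x y h; rewrite ltn0 andbF.
have [c hc] := not_covered_double [seq u i * x | i <- iota 0 k, x <- s] s sK iK.
exists (fun i => if i == k then c else u i) => i j x y h /andP[ij jk] hx hy Kh.
have ik : (i == k) = false by lia.
rewrite ik; case: eqP => [jk'|jk']; last by apply: hu => //; lia.
move=> E; apply: (hc (u i * x) y h) => //; last by rewrite -[c](mulVKg (u i)) E !mulgA.
  by apply/allpairsP; exists (i, x); split => /=; [rewrite mem_iota; lia | exact: hs |].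
exact: hs.
Qed.

Hypothesis noncyclic : forall g : G, ~ finite_index (generated [set g]%classic).

Lemma exists_notin (T : seq G) : exists c, c \notin T.
Proof.
have [c hc] := not_covered_double T [:: 1] (generated_subgroup _) (@noncyclic 1).
exists c; apply/negP => cT; apply: (hc c 1 1) => //; rewrite ?mem_head ?mulg1 //.
exact: (subgroup1 (generated_subgroup _)).
Qed.

(** By [near_axis], commensurability would put [t] into the cyclic subgroup times a ball. Both [g]
    and [g^-1] are treated because the conjugates of powers must diverge at both ends. *)
Lemma lox_diverge g t : loxodromic l delta g ->
  (forall y h, l y <= orbit_const l delta g (8 * delta) ->
     generated [set g]%classic h -> t <> h * y) ->
  exists C, forall n, btw (dist l) C (g ^+ n) 1 (t * g ^+ n) /\
                      btw (dist l) C (g^-1 ^+ n) 1 (t * g^-1 ^+ n).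
Proof.
move=> hg ht; have hgV := loxodromicV hyp_l hg.
have sK := generated_subgroup [set g]%classic.
have Kg : generated [set g]%classic g by move=> M [_]; apply.
have KgV := subgroupV sK Kg.
have [C1 h1] : exists C, forall m n, btw (dist l) C (g ^+ m) 1 (t * g ^+ n).
  case: (diverge_or_commensurate hyp_l t hg hg) => // [[a [b [a0 b0 E]]]].
  have [z [y [Kz ly E']]] : exists z y, [/\ generated [set g]%classic z,
      l y <= orbit_const l delta g (8 * delta) & t = z * y].
    case: E => E; first exact: (near_axis hyp_l hg hg sK Kg a0 b0 E).
    exact: (near_axis hyp_l hg hgV sK Kg a0 b0 E).
  by case: (ht y z).
have [C2 h2] : exists C, forall m n, btw (dist l) C (g^-1 ^+ m) 1 (t * g^-1 ^+ n).
  case: (diverge_or_commensurate hyp_l t hgV hgV) => // [[a [b [a0 b0 E]]]].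
  have [z [y [Kz ly E']]] : exists z y, [/\ generated [set g]%classic z,
      l y <= orbit_const l delta g^-1 (8 * delta) & t = z * y].
    case: E => E; first exact: (near_axis hyp_l hgV hgV sK KgV a0 b0 E).
    rewrite invgK in E; exact: (near_axis hyp_l hgV hg sK KgV a0 b0 E).
  by case: (ht y z) => //; move: ly; rewrite /orbit_const (lenV hyp_l).
exists (maxn C1 C2) => n; split.
  by apply: btw_le (h1 n n); rewrite leq_maxl.
by apply: btw_le (h2 n n); rewrite leq_maxr.
Qed.

(* The elements are conjugates u_i g^N u_i^-1 of a power of a loxodromic g; the
   bound C on their overlaps depends only on g and the u_i, not on N. *)
Lemma diverging_elements k : exists C, forall L, exists s : nat -> G,
  (forall i, i < k -> L <= l (s i)) /\
  (forall i j, i < k -> j < k -> i <> j ->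
     link l C (s i)^-1 (s j) /\ link l C (s i) (s j)^-1).
Proof.
have [g hg] := exists_loxodromic hyp_l exists_notin.
have sK := generated_subgroup [set g]%classic.
have [u hu] := separated_representatives (orbit_const l delta g (8 * delta)) k sK (@noncyclic g).
have hC (p : 'I_k * 'I_k) : exists C, p.1 <> p.2 -> forall n,
    btw (dist l) C (g ^+ n) 1 ((u p.1)^-1 * u p.2 * g ^+ n) /\
    btw (dist l) C (g^-1 ^+ n) 1 ((u p.1)^-1 * u p.2 * g^-1 ^+ n).
  case: p => i j /=; have [->|ij] := eqVneq i j; first by exists 0%N.
  have [|C hC] := @lox_diverge g ((u i)^-1 * u j) hg; last by exists C.
  move=> y h hy Kh E.
  have [lt|lt] : i < j \/ j < i by move: ij; rewrite -val_eqE /=; lia.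
    apply: (hu i j 1 y h) => //; rewrite ?lt ?ltn_ord ?(len1 hyp_l) //.
    by rewrite mul1g.
  (* The representatives are separated for increasing indices; the opposite order follows by
     inversion. *)
  apply: (hu j i y^-1 1 h^-1); rewrite ?lt ?ltn_ord ?(lenV hyp_l) ?(len1 hyp_l) //.
    exact: (subgroupV sK).
  by rewrite mulg1 -invgM -E invgM invgK.
have [C {}hC] := choice hC.
pose Cm := \max_(p : 'I_k * 'I_k) C p; pose U := \max_(i < k) l (u i).
have lU i : i < k -> l (u i) <= U.
  by move=> ik; apply: (leq_bigmax (Ordinal ik) (F := fun i : 'I_k => l (u i))).
(* Conjugation by [u i] shortens [g ^+ N] by at most [2 * U], and moving three points by at most [U]
   each costs [6 * U] in [btw]. *)
exists (Cm + 6 * U) => L; pose N := (L + 2 * U)%N.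
have conjV i : (u i * g ^+ N / u i)^-1 = u i * g^-1 ^+ N / u i.
  by rewrite !invgM invgK expVgn mulgA.
exists (fun i => u i * g ^+ N / u i); split.
  move=> i /lU hi; have := lenM hyp_l (u i)^-1 (u i * g ^+ N / u i * u i).
  have := lenM hyp_l (u i * g ^+ N / u i) (u i).
  have := lox_len hyp_l N hg.
  by rewrite mulgVK mulKg (lenV hyp_l) {1}/N; lia.
move=> i j ik jk ij.
have {}ij : Ordinal ik <> Ordinal jk by move=> /(congr1 val).
have [h1 h2] := hC (Ordinal ik, Ordinal jk) ij N.
have Cle : C (Ordinal ik, Ordinal jk) <= Cm by apply: leq_bigmax.
have conj_link x : btw (dist l) (C (Ordinal ik, Ordinal jk)) x 1 ((u i)^-1 * u j * x) ->
    link l (Cm + 6 * U) (u i * x / u i)^-1 (u j * x / u j).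
  move=> h; rewrite -(btw1_link hyp_l).
  apply: (btw_perturb hyp_d _ _ _ (btw_le Cle (x := u i * x) (v := u i) (y := u j * x) _)).
  - by rewrite (dist_mulr l) (lenV hyp_l) lU.
  - by rewrite (distg1 hyp_l) lU.
  - by rewrite (dist_mulr l) (lenV hyp_l) lU.
  - by rewrite -(btwM l (u i)^-1) mulKg mulVg mulgA.
split; first exact: conj_link.
by have := conj_link _ h2; rewrite -!conjV invgK.
Qed.

(** * Words in the sandwiched copies of [w] *)

Section Pieces.
Variables (I : eqType) (e : I * bool -> G) (w : G) (C L : nat).

Definition signed (u : I * bool) := if u.2 then w else w^-1.

(** The letter [u] opens with the connector [e u] and closes with that of its inverse, uniformly in
    the sign. Between letters [u] and [v] the factors [(e (flip u))^-1] and [e v] meet, and they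
    diverge exactly under the condition [v <> flip u] of reducedness. *)
Definition pieces u := [:: e u; signed u; (e (flip u))^-1].

Definition sandwich i := e (i, true) * w / e (i, false).

Lemma signed_flip u : signed (flip u) = (signed u)^-1.
Proof. by case: u => i []; rewrite /signed //= invgK. Qed.

Lemma sandwich_word ws : word_value sandwich ws = prodg (flatten (map pieces ws)).
Proof.
elim: ws => [|u ws IH]; first by rewrite wv_nil prodg_nil.
rewrite wv_cons /= !prodg_cons -IH !mulgA; congr (_ * _).
case: u => i []; rewrite /word_value big_seq1 /sandwich /signed /flip //=.
by rewrite !invgM invgK mulgA.
Qed.

Hypotheses (e_div : forall u v, u <> v -> link l C (e u)^-1 (e v))
  (e_w : forall u, link l C (e u) (signed u))
  (e_long : forall u, L <= l (e u)) (w_long : L <= l w).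

Lemma chain_pieces ws : reduced ws -> chain l C L (flatten (map pieces ws)).
Proof.
move=> red; apply/andP; split; last first.
  apply/allP => x /flattenP [_ /mapP [u _ ->]].
  have hs : L <= l (signed u) by case: u => i []; rewrite /signed /= ?(lenV hyp_l).
  by rewrite !inE => /or3P[] /eqP -> //; rewrite (lenV hyp_l).
have e_w' u : link l C (signed u) (e (flip u))^-1.
  by rewrite -(linkV hyp_l) invgK -signed_flip.
elim: ws red => [|u ws IH] //= h; rewrite e_w e_w' /=.
case: ws h IH => [|v ws] //= /andP[uv h] IH.
rewrite -/(noncancelling u v) noncancelling_flip in uv.
rewrite e_div /=; last by move=> E; rewrite E eqxx in uv.
exact: IH.
Qed.

End Pieces.

Definition quasiconvex_len (H : set G) eps := forall (c : nat -> G) n,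
  discrete_geodesic (dist l) n c -> H (c 0%N) -> H (c n) ->
  forall i, i <= n -> exists2 h, H h & dist l (c i) h <= eps.

Lemma quasiconvex_near (H : set G) eps C h1 h2 v : quasiconvex_len H eps -> H h1 -> H h2 ->
  btw (dist l) C h1 v h2 -> exists2 h, H h & dist l v h <= eps + (C + C + delta).
Proof.
move=> qc H1 H2 h.
have [p [p0 pl hp]] := len_geodesic hyp_l (h1^-1 * h2).
(* The point of the geodesic at the same distance from [h1] as [v], clamped to the end of the
   geodesic. *)
pose i := minn (dist l h1 v) (dist l h1 h2).
have il : i <= l (h1^-1 * h2) by exact: geq_minr.
have d1 : dist l h1 (h1 * p i) = i.
  by rewrite (dist_mulr l) -(dist1g l) -p0 hp ?subn0.
have d2 : dist l (h1 * p i) h2 = (dist l h1 h2 - i)%N.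
  by rewrite -{1}(mulVKg h1 h2) (distM l) -{1}pl hp // il leqnn.
have h0 : btw (dist l) 0 h1 (h1 * p i) h2.
  by rewrite /btw d1 d2 addn0 subnKC.
have [h' Hh' hd] : exists2 h', H h' & dist l (h1 * p i) h' <= eps.
  apply: (qc (fun i => h1 * p i)) il => //; rewrite ?p0 ?mulg1 ?pl ?mulVKg //.
  by move=> j k jk; rewrite (distM l) hp.
exists h' => //; apply: leq_trans (dist_tri hyp_d v (h1 * p i) h') _.
rewrite addnC leq_add //.
have := @btw_close _ _ _ hyp_d C 0 C h1 h2 v (h1 * p i) h h0.
rewrite addn0; apply; rewrite d1 /i; last by lia.
by move: h; rewrite /btw; lia.
Qed.

(* The axis of f = h ^ g stays close to the coset g^-1 H. *)
Lemma near_coset (H : set G) eps C f g h : quasiconvex_len H eps -> subgroup H -> H h ->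
  f = h ^ g -> exists n0, forall N p, btw (dist l) C 1 p (f ^+ N) ->
    n0 <= l p -> n0 <= dist l p (f ^+ N) ->
    exists2 h', H h' & dist l (g * p) h' <= eps + ((C + 2 * delta) + (C + 2 * delta) + delta).
Proof.
(* Points farther than this from both ends of the axis stay nearly between when the ends are
   replaced by [g^-1] and [g^-1 * h ^+ N], which lie in the coset of [H]. *)
move=> qc sH Hh ->; exists (l g + C + 2 * delta).+1 => N p; rewrite -conjXg => h0 h1 h2.
have {}h0 : btw (dist l) (C + delta) g^-1 p ((h ^+ N) ^ g).
  case/orP: (btw_or hyp_d g^-1 h0) => //.
  rewrite /btw !(dist1g l) (lenV hyp_l).
  by move: (dist_tri hyp_d p g^-1 1); rewrite !(distg1 hyp_l) (lenV hyp_l); lia.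
have {}h0 : btw (dist l) (C + delta + delta) g^-1 p (g^-1 * h ^+ N).
  case/orP: (btw_or hyp_d (g^-1 * h ^+ N) h0) => //; move: h2.
  have E : (h ^+ N) ^ g = g^-1 * h ^+ N * g by rewrite conjgE mulgA.
  by rewrite /btw E (dist_mulr l); lia.
rewrite -(btwM l g) mulVKg mulgV in h0.
have [h' Hh' hd] := quasiconvex_near qc (subgroup1 sH) (subgroupX N sH Hh) h0.
by exists h' => //; apply: leq_trans hd _; lia.
Qed.

Lemma two_of_three (P : nat -> bool) a :
  (forall i j, a <= i < a + 3 -> a <= j < a + 3 -> i <> j -> P i || P j) ->
  exists i j, [/\ a <= i < j, j < a + 3, P i & P j].
Proof.
move=> h; have := h a a.+1; have := h a a.+2; have := h a.+1 a.+2.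
case P0: (P a); case P1: (P a.+1); case P2: (P a.+2) => //= h1 h2 h3.
all: try (by exists a, a.+1; split => //; lia).
all: try (by exists a, a.+2; split => //; lia).
all: try (by exists a.+1, a.+2; split => //; lia).
all: suff: false by []; by [apply: h1; lia | apply: h2; lia | apply: h3; lia].
Qed.

(** Since the [s i] diverge at their far ends, at most one of them overlaps much with a given
    element. The first three supply two connectors for [w], the last three two for [w^-1]; disjoint
    triples make [c] injective. *)
Lemma connectors C (s : nat -> G) w :
  (forall i j, i < 6 -> j < 6 -> i <> j ->
     link l C (s i)^-1 (s j) /\ link l C (s i) (s j)^-1) ->
  exists c : 'I_2 * bool -> nat, [/\ injective c, forall u, c u < 6 &
    forall u, link l (C + delta) (s (c u)) (signed w u)].
Proof.
move=> hs.
have good x i j : i < 6 -> j < 6 -> i <> j ->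
    link l (C + delta) (s i) x || link l (C + delta) (s j) x.
  move=> hi hj ij; have [_ h] := hs i j hi hj ij.
  by case/orP: (link_or hyp_l x h); rewrite ?(linkV hyp_l) => ->; rewrite ?orbT.
have [|i [j [ij j3 gi gj]]] := @two_of_three (fun i => link l (C + delta) (s i) w) 0.
  by move=> i j hi hj; apply: good; lia.
have [|i' [j' [ij' j3' gi' gj']]] := @two_of_three (fun i => link l (C + delta) (s i) w^-1) 3.
  by move=> i0 j0 hi hj; apply: good; lia.
exists (fun u => if u.2 then (if u.1 == ord0 then i else j)
                 else (if u.1 == ord0 then i' else j')).
split.
- move=> [a x] [b y] /=; have [->|a0] := eqVneq a ord0; have [->|b0] := eqVneq b ord0;
    case: x; case: y => E //; try (exfalso; lia).
    by congr (_, _); apply: val_inj; move: a0 b0; case: a b => [[|[|//]] ?] [[|[|//]] ?].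
  by congr (_, _); apply: val_inj; move: a0 b0; case: a b => [[|[|//]] ?] [[|[|//]] ?].
- by move=> [a []] /=; case: ifP => _; lia.
- by move=> [a []] /=; rewrite /signed /=; case: ifP.
Qed.

Theorem exists_separated_free (H : set G) eps :
  subgroup H -> ~ finite_index H -> quasiconvex_len H eps ->
  exists b : 'I_2 -> G,
    (forall ws, reduced ws -> size ws <= l (word_value b ws)) /\
    conjugacy_separated (generated (range b)) H.
Proof.
move=> sH iH qc; have [C hC] := diverging_elements 6.
(* [C1] bounds overlaps of adjacent pieces, [C2] those at a cut of a whole product, and [R] the
   distance from a cut point to the coset of [H]; [L] makes the chain lemmas apply. *)
pose C1 := (C + delta)%N; pose C2 := (C1 + delta.*2)%N.
pose R := (eps + ((C2 + 2 * delta) + (C2 + 2 * delta) + delta))%N.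
pose L := (C1 + 2 * delta).+1.
have [s [s_long hs]] := hC L.
(* One ball serves twice: radius [L] forces [w] to be long, since [H] contains 1, and radius [R]
   yields the final contradiction. *)
have [ball hball] := len_ball hyp_l (R + L).
have [w hw] := not_covered_double ball ball sH iH.
have w_long : L <= l w.
  rewrite leqNgt; apply/negP => hlt; apply: (hw w 1 1); rewrite ?mulg1 //.
  - by apply: hball; lia.
  - by apply: hball; rewrite (len1 hyp_l).
  - exact: subgroup1.
have no_piece u x m y : H m -> l x <= R -> l y <= R -> signed w u <> x * m * y.
  move=> Hm hx hy; rewrite /signed; case: ifP => _ Ew.
    by apply: (hw x y m) => //; apply: hball; lia.
  apply: (hw y^-1 x^-1 m^-1); rewrite ?hball ?(lenV hyp_l) //; try lia.
    exact: subgroupV.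
  by rewrite -[w]invgK Ew !invgM mulgA.
have [c [c_inj c6 c_w]] := connectors w hs.
pose e u := s (c u).
have e_div u v : u <> v -> link l C1 (e u)^-1 (e v).
  move=> uv; apply: (@link_le _ _ C); first by rewrite /C1; lia.
  by case: (hs (c u) (c v)) => // /c_inj.
have e_long u : L <= l (e u) by apply: s_long.
have hchain := chain_pieces e_div c_w e_long w_long.
have hL : C1 + delta < L by rewrite /L; lia.
have hL2 : C1 + delta.*2 < L by rewrite /L; lia.
have size_pieces (ws : seq ('I_2 * bool)) : size (flatten (map (pieces e w) ws)) = (3 * size ws)%N.
  by elim: ws => //= u ws ->; lia.
exists (sandwich e w); split.
  move=> ws /hchain /(len_chain hyp_l hL); rewrite -sandwich_word size_pieces => h.
  by apply: leq_trans h; exact: leq_pmull.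
move=> g; rewrite eqEsubset; split; last first.
  move=> _ ->; split; first by exists 1; [exact: subgroup1 | rewrite conj1g].
  exact: (subgroup1 (generated_subgroup _)).
move=> _ [[h Hh <-] Fx] /=; apply: contrapT => x1.
have [[|u ws] [g' [h' [ws0 cyc Hh' E]]]] :=
  cyclically_reduced_conjugate Fx x1 Hh erefl; first by [].
have [n0 near] := near_coset C2 qc sH Hh' E.
set z := word_value _ _ in E near.
(* The power [z ^+ (n0 + n0.+1)] is split around the first letter [u] of its middle copy, leaving at
   least [n0] pieces on either side, hence distance at least [n0] to both ends. *)
pose pre := flatten (map (pieces e w) (flatten (nseq n0 (u :: ws)))).
pose post := flatten (map (pieces e w) (ws ++ flatten (nseq n0 (u :: ws)))).
have big_chain : chain l C1 L (pre ++ pieces e w u ++ post).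
  have := hchain _ (cycle_nseq_reduced (n0 + n0.+1) cyc).
  by rewrite nseqD flatten_cat map_cat flatten_cat.
have total : prodg (pre ++ pieces e w u ++ post) = z ^+ (n0 + n0.+1).
  have zE m : z ^+ m = prodg (flatten (map (pieces e w) (flatten (nseq m (u :: ws))))).
    by elim: m => [|m IH]; rewrite ?prodg_nil //
      expgS IH /z sandwich_word -prodg_cat -flatten_cat -map_cat.
  by rewrite zE nseqD flatten_cat map_cat flatten_cat.
have nsize m : m <= size (flatten (nseq m (u :: ws))).
  by elim: m => //= m IH; rewrite size_cat; lia.
have point xs ys : pre ++ pieces e w u ++ post = xs ++ ys -> n0 <= size xs -> n0 <= size ys ->
    exists2 h2, H h2 & dist l (g' * prodg xs) h2 <= R.
  move=> Exy sx sy; have hc := big_chain; rewrite Exy in hc.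
  have [cx cy] := chain_cat hc.
  have Ez : z ^+ (n0 + n0.+1) = prodg xs * prodg ys by rewrite -total Exy prodg_cat.
  apply: (near (n0 + n0.+1)%N).
  - rewrite Ez; have := btw_link l C2 1 (prodg xs) (prodg ys); rewrite !mul1g => ->.
    exact: link_split hL2 hc.
  - exact: leq_trans sx (len_chain hyp_l hL cx).
  - by rewrite Ez (dist_mulr l); apply: leq_trans sy (len_chain hyp_l hL cy).
have hpre : n0 <= size pre.
  by rewrite /pre size_pieces; apply: leq_trans (nsize n0) _; exact: leq_pmull.
have hpost : n0 <= size post.
  rewrite /post size_pieces size_cat; apply: leq_trans (nsize n0) _.
  by apply: leq_trans (leq_pmull _ _); rewrite ?leq_addl.
(* The cuts just before and just after the middle copy of [w] or [w^-1] are both within [R] of [H]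
   after translation by [g']. *)
have [h1 Hh1 d1] : exists2 h2, H h2 & dist l (g' * prodg (pre ++ [:: e u])) h2 <= R.
  apply: (point _ ([:: signed w u; (e (flip u))^-1] ++ post)); first by rewrite -catA.
    by rewrite size_cat (leq_trans hpre) ?leq_addr.
  by rewrite size_cat (leq_trans hpost) ?leq_addl.
have [h2 Hh2 d2] : exists2 h2, H h2 & dist l (g' * prodg (pre ++ [:: e u; signed w u])) h2 <= R.
  apply: (point _ ([:: (e (flip u))^-1] ++ post)); first by rewrite -catA.
    by rewrite size_cat (leq_trans hpre) ?leq_addr.
  by rewrite size_cat (leq_trans hpost) ?leq_addl.
pose p := g' * prodg (pre ++ [:: e u]).
have Eq : g' * prodg (pre ++ [:: e u; signed w u]) = p * signed w u.
  by rewrite /p -[[:: e u; _]]/([:: e u] ++ [:: signed w u]) catA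
    [prodg ((_ ++ _) ++ _)]prodg_cat prodg_cons prodg_nil mulg1 mulgA.
rewrite Eq in d2; rewrite -/p in d1.
have Es : signed w u = (p^-1 * h1) * (h1^-1 * h2) * (h2^-1 * (p * signed w u)).
  suff aux a1 a2 a3 a4 : a4 = a1^-1 * a2 * (a2^-1 * a3) * (a3^-1 * (a1 * a4)) :> G by exact: aux.
  by rewrite !mulgA !mulgK mulVg mul1g.
have Hm : H (h1^-1 * h2) by apply: subgroupM => //; exact: subgroupV.
have b1 : l (p^-1 * h1) <= R by [].
have b2 : l (h2^-1 * (p * signed w u)) <= R by rewrite -/(dist l _ _) (dist_sym hyp_d).
exact: no_piece Hm b1 b2 Es.
Qed.

End FreeSubgroup.

(** * Word metrics and thin triangles *)

Section Thin.
Variables (X : Type) (d : X -> X -> nat) (D : nat).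
Hypotheses (d_refl : forall x, d x x = 0) (dC : forall x y, d x y = d y x)
  (dT : forall x y z, d x z <= d x y + d y z).
Hypothesis geo : forall x y, exists c, [/\ c 0 = x, c (d x y) = y & discrete_geodesic d (d x y) c].

Definition thin := forall (c1 c2 c3 : nat -> X) n1 n2 n3,
  discrete_geodesic d n1 c1 -> discrete_geodesic d n2 c2 -> discrete_geodesic d n3 c3 ->
  c1 n1 = c2 0 -> c2 n2 = c3 0 -> c3 n3 = c1 0 ->
  forall i, i <= n1 -> (exists2 j, j <= n2 & d (c1 i) (c2 j) <= D) \/
                       (exists2 j, j <= n3 & d (c1 i) (c3 j) <= D).

Hypothesis hthin : thin.

Lemma on_geodesic c n i : discrete_geodesic d n c -> i <= n ->
  d (c 0) (c i) + d (c i) (c n) = d (c 0) (c n).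
Proof. by move=> hc ilen; rewrite !hc //; lia. Qed.

(* The Gromov product of x and y at w is roughly the distance from w to [x, y]. *)
Lemma geodesic_near_base (c : nat -> X) n w : discrete_geodesic d n c ->
  exists2 i, i <= n &
    (d w (c i)).*2 + d (c 0) (c n) <= d w (c 0) + d w (c n) + (4 * D + 2).
Proof.
move=> hc.
have [c2 [c20 c2n hc2]] := geo (c n) w.
have [c3 [c30 c3n hc3]] := geo w (c 0).
pose P i := `[< exists2 j, j <= d w (c 0) & d (c i) (c3 j) <= D >].
have ex0 : exists i, (i <= n) && P i.
  by exists 0; apply/asboolP; exists (d w (c 0)) => //; rewrite c3n d_refl.
have ub i : (i <= n) && P i -> i <= n by case/andP.
case: (ex_maxnP ex0 ub) => i /andP[ilen /asboolP[j jn hj]] imax.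
exists i => //.
(* [c i] is the last point within [D] of the side from [w] to [c 0]; its successor, if any, is
   within [D] of the other side, hence [D.+1]. *)
have [k kn hk] : exists2 k, k <= d (c n) w & d (c i) (c2 k) <= D.+1.
  have [eq_in|ltin] : i = n \/ i < n by lia.
    by exists 0 => //; rewrite eq_in c20 d_refl.
  have := hthin hc hc2 hc3; rewrite c20 c2n c30 c3n => /(_ erefl erefl erefl _ ltin).
  case=> [[k kn hk]|hP].
    exists k => //; have := dT (c i) (c i.+1) (c2 k).
    by rewrite (hc i i.+1) ?leqnSn // subSnn; lia.
  by have := imax i.+1; rewrite ltin ltnn => /(_ (asboolT hP)).
have := on_geodesic hc ilen; have := on_geodesic hc2 kn; have := on_geodesic hc3 jn.
rewrite c20 c2n c30 c3n.
move: (dT w (c3 j) (c i)) (dT w (c2 k) (c i)) (dT (c 0) (c3 j) (c i)) (dT (c i) (c2 k) (c n)).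
rewrite (dC (c3 j) (c i)) (dC (c2 k) (c i)) (dC (c2 k) (c n)) (dC (c3 j) (c 0)).
rewrite (dC (c2 k) w) (dC (c n) w); lia.
Qed.

(** A point of [[x, z]] nearly realizing the Gromov product at [w] is close to [[z, y]] or [[y, x]],
    and the distance from [w] to a side bounds the Gromov product of its ends from above. *)
Lemma thin_four_point : hyperbolic_metric d (6 * D + 2).
Proof.
split => // x y z w.
have [c1 [c10 c1n hc1]] := geo x z.
have [c2 [c20 c2n hc2]] := geo z y.
have [c3 [c30 c3n hc3]] := geo y x.
have [i ilen] := geodesic_near_base w hc1; rewrite c10 c1n => hi.
have := hthin hc1 hc2 hc3; rewrite c20 c2n c30 c3n c1n c10 => /(_ erefl erefl erefl i ilen).
case=> [] [j jn hj].
  have := on_geodesic hc2 jn; rewrite c20 c2n.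
  move: (dT w (c1 i) (c2 j)) (dT w (c2 j) z) (dT w (c2 j) y).
  rewrite (dC z (c2 j)) (dC y w) (dC y z) (dC z w) (dC x w); lia.
have := on_geodesic hc3 jn; rewrite c30 c3n.
move: (dT w (c1 i) (c3 j)) (dT w (c3 j) y) (dT w (c3 j) x).
rewrite (dC (c3 j) y) (dC y w) (dC x y) (dC z w) (dC x w); lia.
Qed.

End Thin.

(** * Word metrics of a finite generating set *)

Section WordLength.
Local Open Scope group_scope.
Variables (G : groupType) (A : set G).
Hypothesis genA : finite_generating A.

Definition word_length (l : G -> nat) :=
  (forall w : seq (A * bool), l (word_value \val w) <= size w) /\
  (forall g, exists2 w : seq (A * bool), word_value \val w = g & size w = l g).

Lemma exists_word_length : exists l, word_length l.
Proof.
have word g : exists w : seq (A * bool), word_value \val w = g.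
  have [_ /seteqP [_ hA]] := genA.
  apply: (generated_min _ _ (hA g I)
    (K := [set g | exists w : seq (A * bool), word_value \val w = g]%classic)).
    apply: subgroupP => [|x y [w1 <-] [w2 <-]]; first by exists [::]; rewrite wv_nil.
    by exists (w1 ++ rev (map (@flip _) w2)); rewrite wv_cat wvV.
  move=> a Aa; exists [:: (exist _ a (mem_set Aa), true)].
  by rewrite /word_value big_seq1.
have min g : exists n, (exists2 w : seq (A * bool), word_value \val w = g & size w = n) /\
    forall w : seq (A * bool), word_value \val w = g -> n <= size w.
  pose P n := `[< exists2 w : seq (A * bool), word_value \val w = g & size w = n >].
  have exP : exists n, P n by have [w hw] := word g; exists (size w); apply/asboolP; exists w.
  case: (ex_minnP exP) => n /asboolP hn nmin; exists n; split => // w hw.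
  by apply: nmin; apply/asboolP; exists w.
have [l hl] := choice min; exists l; split=> [w|g]; last by have [] := hl g.
by have [_] := hl (word_value \val w); apply.
Qed.

Variable l : G -> nat.
Hypothesis wl : word_length l.

Lemma wl_le (w : seq (A * bool)) : l (word_value \val w) <= size w.
Proof. exact: (proj1 wl). Qed.

Lemma wl_word g : exists2 w : seq (A * bool), word_value \val w = g & size w = l g.
Proof. exact: (proj2 wl). Qed.

Lemma wl1 : l 1 = 0%N.
Proof. by apply/eqP; rewrite -leqn0; have := wl_le [::]; rewrite wv_nil. Qed.

Lemma wl_eq0 g : l g = 0%N -> g = 1.
Proof. by have [[|u w] <- <-] := wl_word g; rewrite ?wv_nil. Qed.

Lemma wlM x y : l (x * y) <= l x + l y.
Proof.
have [w1 <- <-] := wl_word x; have [w2 <- <-] := wl_word y.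
by rewrite -wv_cat -size_cat wl_le.
Qed.

Lemma wlV_le x : l x^-1 <= l x.
Proof.
have [w <- <-] := wl_word x; rewrite wvV; apply: leq_trans (wl_le _) _.
by rewrite size_rev size_map.
Qed.

Lemma wlV x : l x^-1 = l x.
Proof. by apply/eqP; rewrite eqn_leq wlV_le -{1}[x]invgK wlV_le. Qed.

Lemma wdist_refl x : dist l x x = 0%N.
Proof. by rewrite /dist mulVg wl1. Qed.

Lemma wdistC x y : dist l x y = dist l y x.
Proof. by rewrite /dist -wlV invgM invgK. Qed.

Lemma wdistT x y z : dist l x z <= dist l x y + dist l y z.
Proof.
have -> : dist l x z = l (x^-1 * y * (y^-1 * z)) by rewrite /dist -mulgA mulVKg.
exact: wlM.
Qed.

(** Prefixes of a shortest word: the subwords bound the distances from above, and a shorter distance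
    anywhere would shorten the whole by the triangle inequality. *)
Lemma word_geodesic x y : exists c : nat -> G,
  [/\ c 0%N = x, c (dist l x y) = y & discrete_geodesic (dist l) (dist l x y) c].
Proof.
have [w wv sw] := wl_word (x^-1 * y); rewrite -/(dist l x y) in sw.
exists (fun i => x * word_value \val (take i w)).
have e0 : x * word_value \val (take 0 w) = x by rewrite take0 wv_nil mulg1.
have e1 : x * word_value \val (take (dist l x y) w) = y by rewrite -sw take_size wv mulVKg.
split => // i j /andP[ij jn].
have up a b : a <= b <= size w ->
      dist l (x * word_value \val (take a w)) (x * word_value \val (take b w)) <= b - a.
  move=> /andP[ab bn].
  have -> : take b w = take a w ++ drop a (take b w).
    by rewrite -{1}(cat_take_drop a (take b w)) take_takel.
  rewrite wv_cat mulgA dist_mulr.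
  by apply: leq_trans (wl_le _) _; rewrite size_drop size_takel.
apply/eqP; rewrite eqn_leq up /=; last by rewrite ij sw.
have := up 0 i; have := up j (dist l x y); rewrite e0 e1.
set p := x * _; set q := x * _; rewrite -sw in jn *.
move: (wdistT x q y) (wdistT q p y); rewrite -sw leqnn jn (leq_trans ij jn)
  => h1 h2 /(_ isT) h3 /(_ isT) h4.
move: h1 h2 h3 h4; lia.
Qed.

Lemma word_ball n : exists s : seq G, forall g, l g <= n -> g \in s.
Proof.
have [/finite_seqP [sA EA] _] := genA.
elim: n => [|n [s hs]]; first exists [:: 1] => g.
  by rewrite leqn0 => /eqP /wl_eq0 ->; rewrite mem_head.
exists (s ++ [seq a * g | a <- sA ++ map (fun a => a^-1) sA, g <- s]) => g hg.
have [/hs|h] := leqP (l g) n; first by rewrite mem_cat => ->.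
have [[|[a e] w] wv sw] := wl_word g; first by move: h; rewrite -sw.
rewrite mem_cat; apply/orP; right; apply/allpairsP.
exists (word_value \val [:: (a, e)], word_value \val w); split => /=.
- have Asub x : A x -> x \in sA by rewrite EA.
  have Aa := Asub _ (set_valP a).
  rewrite mem_cat /word_value big_seq1 /=; case: e {wv sw}; first by rewrite Aa.
  by rewrite map_f ?orbT.
- by apply: hs; apply: leq_trans (wl_le w) _; move: hg; rewrite -sw /=.
- by rewrite -wv_cons.
Qed.

Lemma word_lipschitz (l' : G -> nat) : l' 1 = 0%N ->
  (forall x y, l' (x * y) <= l' x + l' y) ->
  exists c, forall g, l' g <= c * l g.
Proof.
move=> l1 lM; have [/finite_seqP [sA EA] _] := genA.
pose c := \max_(a <- sA ++ map (fun a => a^-1) sA) l' a; exists c => g.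
have [w <- <-] := wl_word g; elim: w => [|[a e] w IH]; first by rewrite wv_nil l1.
rewrite wv_cons /= mulnS; apply: leq_trans (lM _ _) _; apply: leq_add => //.
apply: (@leq_bigmax_seq _ _ xpredT) => //.
have Asub x : A x -> x \in sA by rewrite EA.
  have Aa := Asub _ (set_valP a).
rewrite mem_cat /word_value big_seq1 /=; case: e; first by rewrite Aa.
by rewrite map_f ?orbT.
Qed.

End WordLength.

Import Order.TTheory GRing.Theory Num.Theory.

(** * Geodesics of the Cayley graph *)

Section CayleyGraph.
Local Open Scope ring_scope.
Variables (R : realType) (G : groupType) (A : set G) (l : G -> nat).
Hypothesis wl : word_length A l.
Implicit Types (p q : cayley R A).
Local Notation vtx := (@Vertex R G A).

Lemma ends_ge0 p u : u \in ends p -> 0 <= u.2.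
Proof.
case: p => [g|g a [t tP]]; rewrite /= !inE; first by move=> /eqP ->.
by move: tP => /set_mem /=; rewrite in_itv /= => /andP[t0 t1] /orP[] /eqP -> /=; lra.
Qed.

Lemma ends_le1 p u : u \in ends p -> u.2 <= 1.
Proof.
case: p => [g|g a [t tP]]; rewrite /= !inE; first by move=> /eqP ->.
by move: tP => /set_mem /=; rewrite in_itv /= => /andP[t0 t1] /orP[] /eqP -> /=; lra.
Qed.

Lemma lengths_has_lbound p q : has_lbound (outer_lengths p q `|` inner_lengths p q)%classic.
Proof.
exists 0 => r [[u [v [w [/ends_ge0 hu /ends_ge0 hv _ ->]]]]|[g [a [t [t' [_ _ ->]]]]]].
  by rewrite !addr_ge0.
exact: normr_ge0.
Qed.

Lemma cayley_dist_le p q u v : u \in ends p -> v \in ends q ->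
  cayley_dist p q <= u.2 + (dist l u.1 v.1)%:R + v.2.
Proof.
move=> hu hv; apply: ge_inf; first exact: lengths_has_lbound.
left; have [w wv sw] := wl_word wl (u.1^-1 * v.1)%g.
by exists u, v, w; split => //; rewrite ?wv ?mulVKg // sw.
Qed.

Lemma cayley_dist_inner_le p q r : inner_lengths p q r -> cayley_dist p q <= r.
Proof. by move=> h; apply: ge_inf; [exact: lengths_has_lbound | right]. Qed.

Lemma outer_lengths_ge p q r : outer_lengths p q r ->
  exists u v, [/\ u \in ends p, v \in ends q & u.2 + (dist l u.1 v.1)%:R + v.2 <= r].
Proof.
move=> [u [v [w [hu hv E ->]]]]; exists u, v; split => //.
rewrite /dist E mulKg; have := wl_le wl w; rewrite -(ler_nat R); lra.
Qed.

Lemma ends_neq0 p : exists u, u \in ends p.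
Proof. by case: p => [g|g a t]; [exists (g, 0) | exists (g, \val t)]; rewrite /= inE eqxx. Qed.

Lemma lengths_neq0 p q : (outer_lengths p q `|` inner_lengths p q !=set0)%classic.
Proof.
have [u hu] := ends_neq0 p; have [v hv] := ends_neq0 q.
have [w wv sw] := wl_word wl (u.1^-1 * v.1)%g.
exists (u.2 + (size w)%:R + v.2); left; exists u, v, w; split => //.
by rewrite wv mulVKg.
Qed.

Lemma cayley_distC p q : cayley_dist p q = cayley_dist q p.
Proof.
suff le p' q' : cayley_dist p' q' <= cayley_dist q' p' by apply/eqP; rewrite eq_le !le.
apply: lb_le_inf; first exact: lengths_neq0.
move=> r [/outer_lengths_ge [u [v [hu hv]]]|[g [a [t [t' [-> -> ->]]]]]].
  apply: le_trans; apply: le_trans (cayley_dist_le hv hu) _; rewrite (wdistC wl); lra.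
by apply: cayley_dist_inner_le; exists g, a, t', t; rewrite distrC.
Qed.

(** No inner path starts at a vertex, so the distance is read off at an end of the edge of [q]. The
    inequality is strict because the distance is an infimum. *)
Lemma vertex_dist_lt g q r : cayley_dist (vtx g) q < r ->
  exists2 v, v \in ends q & (dist l g v.1)%:R + v.2 < r.
Proof.
move=> /(inf_lt (lengths_neq0 _ _)) [s [/outer_lengths_ge|]].
  move=> [u [v []]]; rewrite /= inE => /eqP -> hv /= h1 h2.
  by exists v => //; apply: le_lt_trans h2; move: h1; rewrite add0r.
by move=> [g' [a [t [t' []]]]].
Qed.

Lemma dist_vertex_lt q g r : cayley_dist q (vtx g) < r ->
  exists2 v, v \in ends q & v.2 + (dist l v.1 g)%:R < r.
Proof.
move=> /(inf_lt (lengths_neq0 _ _)) [s [/outer_lengths_ge|]].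
  move=> [v [u []]] hv; rewrite /= inE => /eqP -> /= h1 h2.
  by exists v => //; apply: le_lt_trans h2; move: h1; rewrite addr0.
by move=> [g' [a [t [t' [_ //]]]]].
Qed.

Lemma cayley_dist_vertex g h : cayley_dist (vtx g) (vtx h) <= (dist l g h)%:R.
Proof.
have := @cayley_dist_le (vtx g) (vtx h) (g, 0) (h, 0).
by rewrite /= !inE !eqxx => /(_ isT isT); rewrite add0r addr0.
Qed.

Lemma ends_close p u v : u \in ends p -> v \in ends p -> (dist l u.1 v.1 <= 1)%N.
Proof.
have da g (a : A) : (dist l g (g * \val a)%g <= 1)%N.
  rewrite dist_mulr; have := wl_le wl [:: (a, true)].
  by rewrite /word_value big_seq1.
case: p => [g|g a t]; rewrite /= !inE.
  by move=> /eqP -> /eqP ->; rewrite (wdist_refl wl).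
by move=> /orP[] /eqP -> /orP[] /eqP -> /=; rewrite ?(wdist_refl wl) ?da // (wdistC wl) da.
Qed.

(** * Realization of a discrete geodesic in the Cayley graph *)

Section RealGeodesic.
Variables (c : nat -> G) (n : nat).
Hypothesis hc : discrete_geodesic (dist l) n c.

Lemma geodesic_dist i j : (i <= n)%N -> (j <= n)%N ->
  (dist l (c i) (c j))%:R = `|i%:R - j%:R| :> R.
Proof.
move=> ilen jlen; wlog ij : i j ilen jlen / (i <= j)%N.
  by move=> H; have [/H|/ltnW /H] := leqP i j; [apply | rewrite (wdistC wl) distrC; apply].
by rewrite hc ?ij // natrB // distrC ger0_norm // subr_ge0 ler_nat.
Qed.

(* One letter is chosen per edge of c: when A contains a generator and its
   inverse there are two edges between consecutive vertices. *)
Definition letter_at (o : nat -> option (A * bool)) := forall i, (i < n)%N ->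
  exists2 u, o i = Some u & c i.+1 = (c i * word_value \val [:: u])%g.

Lemma exists_letters : exists o, letter_at o.
Proof.
have ex i : exists u, (i < n)%N ->
    exists2 v, u = Some v & c i.+1 = (c i * word_value \val [:: v : A * bool])%g.
  have [ltin|] := ltnP i n; last by exists None.
  have [w wv sw] := wl_word wl ((c i)^-1 * c i.+1)%g.
  move: sw; rewrite -/(dist l _ _) hc ?leqnSn // subSnn.
  case: w wv => [|u [|? ?]] // wv _; exists (Some u) => _; exists u => //.
  by rewrite wv mulVKg.
by have [o ho] := choice ex; exists o.
Qed.

Variable o : nat -> option (A * bool).
Hypothesis ho : letter_at o.

(** A letter [(a, false)] runs backwards along the edge that starts at [c i.+1], so [t] is then
    measured from the far end of the step. *)
Definition edge_point i (u : A * bool) (t : `]0 : R, 1[%classic) : cayley R A :=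
  if u.2 then EdgePoint (c i) u.1 t else EdgePoint (c i.+1) u.1 t.

Definition edge_position i (u : A * bool) (t : `]0 : R, 1[%classic) : R :=
  if u.2 then i%:R + \val t else i.+1%:R - \val t.

(** The graph of the arc-length parametrization, kept as a relation until a function is chosen. *)
Definition position (s : R) (x : cayley R A) :=
  (exists i, [/\ (i <= n)%N, x = vtx (c i) & s = i%:R]) \/
  (exists i u t, [/\ (i < n)%N, o i = Some u, x = edge_point i u t & s = edge_position i u t]).

Lemma unit_itv (t : `]0 : R, 1[%classic) : 0 < \val t < 1.
Proof. by have := set_valP t; rewrite /= in_itv. Qed.

Lemma edge_position_bounds i u t : i%:R < edge_position i u t < i.+1%:R.
Proof.
have /andP[t0 t1] := unit_itv t; rewrite /edge_position -natr1.
by case: u.2; apply/andP; split; lra.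
Qed.

Lemma edge_point_ends i u t : (i < n)%N -> o i = Some u ->
  ends (edge_point i u t) =i
  [:: (c i, edge_position i u t - i%:R); (c i.+1, i.+1%:R - edge_position i u t)].
Proof.
move=> ltin E; have [v] := ho ltin; rewrite E => -[<-].
case: u {E} => a [] /= E; rewrite /edge_point /edge_position /= => x.
  rewrite !inE E /word_value big_seq1 /=; congr ((x == (_, _)) || (x == (_, _))).
    lra.
  by rewrite -natr1; lra.
have E2 : (c i.+1 * \val a)%g = c i by rewrite E /word_value big_seq1 /= mulgVK.
rewrite !inE E2 orbC; congr ((x == (_, _)) || (x == (_, _))).
  by rewrite -natr1; lra.
lra.
Qed.

Lemma position_ends s x u : position s x -> u \in ends x ->
  exists i, [/\ (i <= n)%N, u.1 = c i & u.2 = `|s - i%:R|].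
Proof.
case=> [[i [ilen -> ->]]|[i [v [t [ltin E -> ->]]]]].
  by rewrite /= inE => /eqP ->; exists i; rewrite subrr normr0.
have /andP[s0 s1] := edge_position_bounds i v t.
rewrite edge_point_ends // !inE => /orP[] /eqP ->.
  by exists i; rewrite ger0_norm ?subr_ge0 ?(ltW s0) // ltnW.
by exists i.+1; rewrite distrC ger0_norm ?subr_ge0 ?(ltW s1).
Qed.

Lemma position_floor s x : position s x ->
  exists i, [/\ (i <= n)%N, i%:R <= s < i.+1%:R & (c i, s - i%:R) \in ends x].
Proof.
case=> [[i [ilen -> ->]]|[i [v [t [ltin E -> ->]]]]].
  by exists i; rewrite lexx ltr_nat ltnSn subrr /= inE eqxx.
have /andP[s0 s1] := edge_position_bounds i v t.
by exists i; rewrite ltnW // (ltW s0) s1 edge_point_ends // !inE eqxx.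
Qed.

Lemma position_ceil s x : position s x ->
  exists i, [/\ (i <= n)%N, i%:R - 1 < s <= i%:R & (c i, i%:R - s) \in ends x].
Proof.
case=> [[i [ilen -> ->]]|[i [v [t [ltin E -> ->]]]]].
  by exists i; rewrite lexx subrr /= inE eqxx ltrBlDr ltrDl ltr01.
have /andP[s0 s1] := edge_position_bounds i v t.
by exists i.+1; rewrite (ltW s1) -{1}natr1 addrK s0 edge_point_ends // !inE eqxx orbT.
Qed.

Lemma position_dist_le s t x y : position s x -> position t y -> s <= t ->
  cayley_dist x y <= t - s.
Proof.
move=> hx hy st.
have [i [ilen /andP[i0 i1] hi]] := position_ceil hx.
have [j [jlen /andP[j0 j1] hj]] := position_floor hy.
(* Either a vertex of the path separates the two parameters, or both lie inside one open edge and
   the inner path is used. *)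
have [ij|ji] := leqP i j.
  have := cayley_dist_le hi hj; rewrite /= geodesic_dist // distrC ger0_norm ?subr_ge0 ?ler_nat //.
  by move=> /le_trans; apply; lra.
have ji' : (j.+1%:R : R) <= i%:R by rewrite ler_nat.
have s1 : s < j.+1%:R by apply: le_lt_trans j1.
have s0 : j%:R < s by rewrite -natr1 in ji'; lra.
have inner z (r : R) : position r z -> j%:R < r -> r < j.+1%:R ->
    exists u t, [/\ o j = Some u, z = edge_point j u t & r = edge_position j u t].
  case=> [[k [_ _ ->]]|[k [u [v [ltkn E -> ->]]]]].
    by rewrite !ltr_nat ltnS => h1 /(leq_trans h1); rewrite ltnn.
  have /andP[h0 h1] := edge_position_bounds k u v => h2 h3.
  have jk : j = k.
    apply/eqP; rewrite eqn_leq -(ltnS j) -(ltnS k) -!(ltr_nat R).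
    by rewrite (lt_trans h2 h1) (lt_trans h0 h3).
  by subst k; exists u, v.
have [u [a [Eu -> Es]]] := inner _ _ hx s0 s1.
have [v [b [Ev -> Et]]] := inner _ _ hy (lt_le_trans s0 st) j1.
move: Ev; rewrite Eu => -[?]; subst v.
apply: cayley_dist_inner_le; rewrite /edge_point.
have Eabs : `|t - s| = t - s by rewrite ger0_norm ?subr_ge0.
rewrite -Eabs Es Et /edge_position; case: u.2.
  by exists (c j), u.1, a, b; split => //; rewrite distrC; congr `|_|; lra.
by exists (c j.+1), u.1, a, b; split => //; congr `|_|; lra.
Qed.

Lemma position_dist_ge s t x y : position s x -> position t y ->
  `|s - t| <= cayley_dist x y.
Proof.
move=> hx hy; apply: lb_le_inf; first exact: lengths_neq0.
move=> r [/outer_lengths_ge [u [v [hu hv hr]]]|[g [a [t1 [t2 [E1 E2 ->]]]]]].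
  have [i [ilen ui u2]] := position_ends hx hu; have [j [jlen vj v2]] := position_ends hy hv.
  apply: le_trans hr; rewrite ui vj geodesic_dist // u2 v2.
  have -> : s - t = (s - i%:R) + (i%:R - j%:R) + (j%:R - t) by lra.
  rewrite (distrC t); apply: le_trans (ler_normD _ _) _; rewrite lerD2r; exact: ler_normD.
have cinj i j : (i <= n)%N -> (j <= n)%N -> c i = c j -> i = j.
  move=> ilen jlen Ec; have := geodesic_dist ilen jlen.
  rewrite Ec (wdist_refl wl) => /esym /eqP; rewrite normr_eq0 subr_eq0 eqr_nat.
  by move/eqP.
(* One edge traversed once in each direction would make the path revisit its vertices, contrary to
   injectivity. *)
have cross i j u v : (i < n)%N -> (j < n)%N -> o i = Some u -> o j = Some v ->
    u.2 -> ~~ v.2 -> u.1 = v.1 -> c i = c j.+1 -> False.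
  move=> ltin ltjn Eu Ev u2 v2 uv Ec.
  have [u' ] := ho ltin; rewrite Eu => -[<-]; have [v'] := ho ltjn; rewrite Ev => -[<-].
  case: u v u2 v2 uv {Eu Ev} => a1 [] [a2 []] //= _ _ ->.
  rewrite /word_value !big_seq1 /= => Ej Ei.
  have : c i.+1 = c j by rewrite Ei Ec Ej mulgVK.
  by move: Ec => /(cinj _ _ (ltnW ltin) ltjn) ? /(cinj _ _ ltin (ltnW ltjn)); lia.
case: hx E1 => [[i [_ -> _]] //|[i [u [v1 [ltin Eu -> ->]]]]].
case: hy E2 => [[j [_ -> _]] //|[j [u' [v2 [ltjn Eu' -> ->]]]]].
rewrite /edge_point /edge_position.
case u2: u.2; case u2': u'.2 => -[Ec2 Ea2 <-] [Ec1 Ea1 <-].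
- have ij : i = j by apply: cinj; rewrite ?Ec1 ?Ec2 // ltnW.
  by rewrite ij le_eqVlt; apply/orP; left; apply/eqP; congr `|_|; lra.
- by case: (cross i j u u'); rewrite ?u2 ?u2' ?Ea1 ?Ea2 ?Ec1 ?Ec2.
- by case: (cross j i u' u); rewrite ?u2 ?u2' ?Ea1 ?Ea2 ?Ec1 ?Ec2.
- have [ij] : i.+1 = j.+1 by apply: cinj; rewrite ?Ec1 ?Ec2.
  by rewrite ij distrC le_eqVlt; apply/orP; left; apply/eqP; congr `|_|; lra.
Qed.

Lemma exists_position s : 0 <= s <= n%:R -> exists x, position s x.
Proof.
move=> /andP[s0 sn]; pose i := Num.truncn s.
have /andP[i0 i1] : i%:R <= s < i.+1%:R by rewrite truncn_itv.
have ilen : (i <= n)%N by rewrite -(ler_nat R); apply: le_trans sn.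
have [si|si] := eqVneq s i%:R; first by exists (vtx (c i)); left; exists i.
have {si} i0' : i%:R < s by rewrite lt_neqAle eq_sym si.
have ltin : (i < n)%N by rewrite -(ltr_nat R); apply: lt_le_trans sn.
have [u Eu _] := ho ltin; rewrite -natr1 in i1.
case u2 : u.2.
  have tP : s - i%:R \in `]0 : R, 1[%classic by apply/mem_set; rewrite /= in_itv /=; lra.
  exists (edge_point i u (SigSub tP)); right; exists i, u, (SigSub tP); split => //.
  by rewrite /edge_position u2 /=; lra.
have tP : i.+1%:R - s \in `]0 : R, 1[%classic.
  by apply/mem_set; rewrite /= in_itv /= -natr1; lra.
exists (edge_point i u (SigSub tP)); right; exists i, u, (SigSub tP); split => //.
by rewrite /edge_position u2 /=; lra.
Qed.

Lemma position_vertex i x : (i <= n)%N -> position i%:R x -> x = vtx (c i).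
Proof.
move=> ilen [[j [_ -> /eqP]]|[j [u [t [_ _ _ E]]]]].
  by rewrite eqr_nat => /eqP ->.
by have := edge_position_bounds j u t; rewrite -E !ltr_nat; lia.
Qed.

End RealGeodesic.

Lemma real_geodesic (c : nat -> G) n : discrete_geodesic (dist l) n c ->
  exists p : R -> cayley R A, [/\ geodesic cayley_dist n%:R p,
    forall i, (i <= n)%N -> p i%:R = vtx (c i) &
    forall t u, t \in `[0, n%:R] -> u \in ends (p t) -> exists2 i, (i <= n)%N & u.1 = c i].
Proof.
move=> hc; have [o ho] := exists_letters hc.
(* Outside [[0, n]] the value is arbitrary. *)
have ex s : exists x, 0 <= s <= n%:R -> position c n o s x.
  case: (boolP (0 <= s <= n%:R)) => [/(exists_position ho) [x hx]|_]; first by exists x.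
  by exists (vtx 1%g).
have [p hp] := choice ex; exists p; split.
- split=> [|s t]; first exact: ler0n.
  rewrite !in_itv /= => /hp hs /hp ht; apply/eqP.
  rewrite eq_le (position_dist_ge hc ho hs ht) andbT.
  have [st|/ltW ts] := leP s t.
    by rewrite distrC ger0_norm ?subr_ge0 // (position_dist_le hc ho hs ht).
  by rewrite cayley_distC ger0_norm ?subr_ge0 // (position_dist_le hc ho ht hs).
- move=> i ilen; apply: (position_vertex ilen); apply: hp.
  by rewrite ler0n ler_nat.
- move=> t u; rewrite in_itv /= => /hp ht /(position_ends ho ht) [i [ilen ui _]].
  by exists i.
Qed.

End CayleyGraph.

(** * Transfer between the Cayley graph and the word metric *)

Section Transfer.
Local Open Scope ring_scope.
Variables (R : realType) (G : groupType).
Implicit Types (A H : set G) (l : G -> nat).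

Lemma natr_lt_trunc (r : R) m : 0 <= r -> m%:R < r + 1 -> (m <= (Num.truncn r).+1)%N.
Proof.
move=> r0 h; have := truncnS_gt r; rewrite -ltnS -(ltr_nat R) -natr1; lra.
Qed.

(** The nearby point on another side is replaced by an end of its edge, which is a vertex of that
    discrete geodesic; rounding the strict bound [delta + 1] gives the constant. *)
Lemma slim_thin A l (delta : R) : word_length A l -> 0 <= delta ->
  slim_triangles (@cayley_dist R G A) delta -> thin (dist l) (Num.truncn delta).+1.
Proof.
move=> wl d0 slim c1 c2 c3 n1 n2 n3 h1 h2 h3 e1 e2 e3 i ilen.
have [p1 [g1 v1 _]] := real_geodesic R wl h1.
have [p2 [g2 v2 en2]] := real_geodesic R wl h2.
have [p3 [g3 v3 en3]] := real_geodesic R wl h3.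
have p0 (p : R -> cayley R A) : p 0 = p 0%:R by rewrite mulr0n.
have [|sl _ _] := slim n1%:R n2%:R n3%:R p1 p2 p3.
  by split; split; rewrite ?p0 ?v1 ?v2 ?v3 ?e1 ?e2 ?e3.
have [|y [[t ht <-]|[t ht <-]]] := sl (p1 i%:R).
- by exists i%:R => //=; rewrite in_itv /= ler0n ler_nat.
- rewrite v1 // => hd; left.
  have [|v hv hlt] := vertex_dist_lt wl (r := delta + 1) (g := c1 i) (q := p2 t).
    by apply: le_lt_trans hd _; rewrite ltrDl.
  have [j jn Ej] := en2 _ _ ht hv; exists j => //; apply: natr_lt_trunc d0 _.
  by rewrite -Ej; have := ends_ge0 hv; lra.
- rewrite v1 // => hd; right.
  have [|v hv hlt] := vertex_dist_lt wl (r := delta + 1) (g := c1 i) (q := p3 t).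
    by apply: le_lt_trans hd _; rewrite ltrDl.
  have [j jn Ej] := en3 _ _ ht hv; exists j => //; apply: natr_lt_trunc d0 _.
  by rewrite -Ej; have := ends_ge0 hv; lra.
Qed.

Lemma word_length_hyperbolic A l : hyperbolic R G -> finite_generating A ->
  word_length A l -> exists d, hyperbolic_length l d.
Proof.
move=> [_ hyp] gA wl; have [delta d0 slim] := hyp A gA.
exists (6 * (Num.truncn delta).+1 + 2)%N; split.
- exact: (thin_four_point (wdist_refl wl) (wdistC wl) (wdistT wl)
    (word_geodesic wl) (slim_thin wl d0 slim)).
- by move=> g; have := word_geodesic wl 1%g g; rewrite /dist invg1 mul1g.
- move=> n; exact: (word_ball gA wl n).
Qed.

Lemma quasiconvex_word_length A l H : finite_generating A -> word_length A l ->
  quasiconvex R H -> exists eps, quasiconvex_len l H eps.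
Proof.
move=> gA wl qc; have [eps e0 he] := qc A gA.
exists (Num.truncn eps).+1 => c n hc H0 Hn i ilen.
have [p [gp vp _]] := real_geodesic R wl hc.
have Hp0 : (@Vertex R G A @` H)%classic (p 0) by exists (c 0%N) => //; rewrite -(vp 0%N) ?mulr0n.
have Hpn : (@Vertex R G A @` H)%classic (p n%:R) by exists (c n) => //; rewrite vp.
have [|y [h Hh <-]] := he _ _ gp Hp0 Hpn (p i%:R).
  by exists i%:R => //=; rewrite in_itv /= ler0n ler_nat.
rewrite vp // => hd; exists h => //.
have [|v] := vertex_dist_lt wl (r := eps + 1) (g := c i) (q := @Vertex R G A h).
  by apply: le_lt_trans hd _; rewrite ltrDl.
by rewrite /= inE => /eqP -> /=; rewrite addr0; apply: natr_lt_trunc.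
Qed.

(* In any other word metric the orbit paths of F are still quasi-geodesics, so
   that the Morse lemma applies. *)
Lemma undistorted_quasiconvex (I : finType) (b : I -> G) A l :
  hyperbolic R G -> finite_generating A -> word_length A l ->
  (forall ws, reduced ws -> (size ws <= l (word_value b ws))%N) ->
  quasiconvex R (generated (range b)).
Proof.
move=> hypG gA wl und A' gA'; have [l' wl'] := exists_word_length gA'.
have [d hl'] := word_length_hyperbolic hypG gA' wl'.
have hd := len_metric hl'.
have [c hc] := word_lipschitz gA' wl' (wl1 wl) (wlM wl).
pose B := \max_(i : I) l' (b i).
have [D hD] := morse hd B c.
(* The end [u] of the edge of [p t] is within [6 + d] of a discrete geodesic, which is within [D] of
   the path in [F]; the extra 1 reaches [u] from [p t]. *)
pose E := (6 + d + D)%N; exists (E.+1%:R : R); first exact: ler0n.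
move=> r p [r0 gp] [f1 F1 E1] [f2 F2 E2] _ [t ht <-].
have r0' : 0 \in `[0, r] by rewrite in_itv /= lexx r0.
have rr' : r \in `[0, r] by rewrite in_itv /= lexx r0.
have d1 : cayley_dist (p 0) (p t) = t.
  by rewrite gp // sub0r normrN ger0_norm //; move: ht; rewrite /= in_itv /= => /andP[].
have d2 : cayley_dist (p t) (p r) = r - t.
  by rewrite gp // distrC ger0_norm // subr_ge0; move: ht; rewrite /= in_itv /= => /andP[].
have d3 : cayley_dist (p 0) (p r) = r by rewrite gp // sub0r normrN ger0_norm.
rewrite -E1 in d1 d3; rewrite -E2 in d2 d3.
have [|u hu lu] := vertex_dist_lt wl' (r := t + 1) (g := f1) (q := p t).
  by rewrite d1 ltrDl.
have [|u' hu' lu'] := dist_vertex_lt wl' (r := r - t + 1) (g := f2) (q := p t).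
  by rewrite d2 ltrDl.
(* The constant 3 is one for each strict bound, plus one because [u] and [u'] may be opposite ends
   of the edge. *)
have hbtw : btw (dist l') 3 f1 u.1 f2.
  rewrite /btw -(ler_nat R) !natrD.
  have := cayley_dist_vertex R wl' f1 f2; rewrite d3 => hr.
  have := wdistT wl' u.1 u'.1 f2; rewrite -(ler_nat R) natrD => ht1.
  have := ends_close wl' hu hu'; rewrite -(ler_nat R) => ht2.
  have := ends_ge0 hu; have := ends_ge0 hu'; lra.
have [ws red Ews] : exists2 ws, reduced ws & (f1^-1 * f2)%g = word_value b ws.
  apply: reduced_word.
  have sF := generated_subgroup (range b).
  exact: (subgroupM sF (subgroupV sF F1) F2).
(* The prefixes of the reduced word trace a path from [f1] to [f2] inside the subgroup. *)
pose q i := (f1 * word_value b (take i ws))%g.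
have q0 : q 0%N = f1 by rewrite /q take0 wv_nil mulg1.
have qn : q (size ws) = f2 by rewrite /q take_size -Ews mulVKg.
have sub i j : (i <= j <= size ws)%N -> q j = (q i * word_value b (drop i (take j ws)))%g.
  move=> /andP[ij jn]; rewrite /q -mulgA -wv_cat; congr (_ * word_value b _)%g.
  by rewrite -{1}(cat_take_drop i (take j ws)) take_takel.
have qstep i : (i < size ws)%N -> (dist l' (q i) (q i.+1) <= B)%N.
  move=> iw; rewrite (@sub i i.+1) ?leqnSn // dist_mulr.
  have : size (drop i (take i.+1 ws)) = 1%N by rewrite size_drop size_takel // subSnn.
  case: (drop _ _) => [|[x e] [|? ?]] // _; rewrite /word_value big_seq1 /=.
  have lB : (l' (b x) <= B)%N by apply: leq_bigmax.
  by case: e => //; rewrite (wlV wl').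
(* Subwords of a reduced word are reduced, hence undistorted for [l], and [l] is bounded by [c]
   times [l']. *)
have qlen i j : (i <= j <= size ws)%N -> (j - i <= c * dist l' (q i) (q j))%N.
  move=> hij; rewrite (sub _ _ hij) dist_mulr; apply: leq_trans (hc _).
  apply: leq_trans (und _ _); last by apply/drop_sorted/take_sorted.
  by case/andP: hij => ij jn; rewrite size_drop size_takel.
have [g [g0 gn hg]] := word_geodesic wl' f1 f2.
pose i := minn (dist l' f1 u.1) (dist l' f1 f2).
have il : (i <= dist l' f1 f2)%N by exact: geq_minr.
have dg1 : dist l' f1 (g i) = i by rewrite -g0 hg ?subn0.
have dg2 : dist l' (g i) f2 = (dist l' f1 f2 - i)%N by rewrite -{1}gn hg // il leqnn.
have hbi : btw (dist l') 0 f1 (g i) f2 by rewrite /btw dg1 dg2 addn0 subnKC.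
have hui : (dist l' u.1 (g i) <= 6 + d)%N.
  have := @btw_close _ _ _ hd 3 0 3 f1 f2 u.1 (g i) hbtw hbi.
  rewrite dg1; apply; last exact: leq_trans (geq_minl _ _) (leq_addr _ _).
  by rewrite /i addn_minl leq_min leq_addr /=; apply: leq_trans (leq_addr _ _) hbtw.
have [||j jw hj] := hD q g (size ws) (dist l' f1 f2) qstep qlen hg _ _ i il.
- by rewrite g0 q0.
- by rewrite gn qn.
have sF := generated_subgroup (range b).
have Fq : generated (range b) (q j).
  have h1 := @word_generated _ _ b (take j ws). have h2 := subgroupM sF F1 h1. exact: h2.
exists (@Vertex R G A' (q j)); first by exists (q j).
have := cayley_dist_le wl' (p := p t) (q := @Vertex R G A' (q j)) hu (mem_head (q j, 0) [::]).
rewrite /= addr0 => /le_trans; apply.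
have hE : (dist l' u.1 (q j) <= E)%N.
  by apply: leq_trans (wdistT wl' _ (g i) _) _; rewrite /E leq_add.
rewrite -(ler_nat R) in hE; rewrite -natr1.
have := ends_le1 hu; lra.
Qed.

End Transfer.

Theorem theorem1p5 (R : realType) (G : groupType) (H : set G) :
  nonelementary_hyperbolic R G ->
  subgroup H -> quasiconvex R H -> ~ finite_index H ->
  exists F : set G,
    [/\ subgroup F, free_of_rank 2 F, quasiconvex R F &
        conjugacy_separated F H].
Proof.
move=> [hypG nvc] sH qc iH; have [[A gA] _] := hypG.
have [l wl] := exists_word_length gA.
have [d hl] := word_length_hyperbolic hypG gA wl.
have [eps qcl] := quasiconvex_word_length gA wl qc.
have nc (g : G) : ~ finite_index (generated [set g]%classic).
  move=> fi; apply: nvc; exists (generated [set g]%classic).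
  by split => //; [exact: generated_subgroup | exists g].
have [b [und sep]] := exists_separated_free hl nc sH iH qcl.
exists (generated (range b)); split => //.
- exact: generated_subgroup.
- exists b; split => // ws ws0 red E.
  by have := und ws red; rewrite E (wl1 wl) leqn0 size_eq0 (negPf ws0).
- exact: undistorted_quasiconvex hypG gA wl und.
Qed.
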